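(* Let $\gamma_n: S^1 \to \mathbb{R}^3$ ($n=1,2,3,\dots$) be a sequence of $C^3$ maps converging in the $C^3$ sense to $\gamma: S^1 \to \mathbb{R}^3$. Assume that: (i) the image of $\gamma$ lies in a plane and is not a point; (ii) for each $n$, $\gamma_n$ has constant speed $c_n>0$, non-vanishing curvature $\kappa_n$, and constant nonzero torsion $\tau_n\neq 0$. Then $\gamma$ is not an embedding. In particular, its image has a self-intersection, i.e. $\gamma(s)=\gamma(t)$ for some $s\neq t$ in $S^1$.
   Context: $S^1=\mathbb{R}/2\pi\mathbb{Z}$ with its standard parameter $t$; speed means $|\gamma_n'(t)|$. Convergence in the $C^3$ sense means uniform convergence of the maps together with their derivatives up to order three. Torsion convention: for a curve parametrized by arc length with nonzero curvature $\kappa=|\gamma''|$, the Frenet frame satisfies $T'=\kappa N$, $N'=-\kappa T+\tau B$, $B'=-\tau N$; in an arbitrary regular parametrization, $\tau=\dfrac{(\gamma'\times\gamma'')\cdot\gamma'''}{|\gamma'\times\gamma''|^2}$. The constants $c_n$ and $\tau_n$ may depend on $n$. *)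

(* Defs.v *)
From Stdlib Require Import Reals ZArith Lra.
From Stdlib Require Import FunctionalExtensionality PropExtensionality ProofIrrelevance.
From Coquelicot Require Import Coquelicot.

Open Scope R_scope.

(* S1 is R / 2 PI Z, as the type of cosets of 2 PI Z in R. *)

Definition coset (t : R) : R -> Prop :=
  fun s => exists k : Z, s = t + 2 * PI * IZR k.

Definition S1 : Type := {A : R -> Prop | exists t : R, A = coset t}.

Definition angle (t : R) : S1 :=
  exist (fun A : R -> Prop => exists u : R, A = coset u) (coset t)
    (ex_intro (fun u : R => coset t = coset u) t eq_refl).

Lemma angle_surj (p : S1) : exists t : R, p = angle t.
Proof.
destruct p as [A [t Ht]]; exists t; subst A; unfold angle.
apply f_equal, proof_irrelevance.
Qed.

Lemma angle_eq (s t : R) :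
  angle s = angle t <-> exists k : Z, s = t + 2 * PI * IZR k.
Proof.
split.
- intros H.
  assert (E : coset s = coset t) by exact (f_equal (@proj1_sig _ _) H).
  change (coset t s); rewrite <- E; exists 0%Z; ring.
- intros [k Hk].
  assert (E : coset s = coset t).
  { apply functional_extensionality; intros u.
    apply propositional_extensionality; split; intros [j Hj].
    - exists (k + j)%Z; rewrite plus_IZR; lra.
    - exists (j - k)%Z; rewrite minus_IZR; lra. }
  unfold angle; generalize (ex_intro (fun u : R => coset s = coset u) s eq_refl).
  rewrite E; intros e.
  apply f_equal, proof_irrelevance.
Qed.

(* The quotient topology of R / 2 PI Z. *)
Definition open_S1 (U : S1 -> Prop) : Prop := open (fun t : R => U (angle t)).

Definition R3 : Type := (R * R * R)%type.

Definition open_R3 (V : R3 -> Prop) : Prop :=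
  @open (prod_UniformSpace (prod_UniformSpace R_UniformSpace R_UniformSpace)
           R_UniformSpace) V.

Definition c1 (p : R3) : R := fst (fst p).
Definition c2 (p : R3) : R := snd (fst p).
Definition c3 (p : R3) : R := snd p.

Definition sub3 (p q : R3) : R3 := (c1 p - c1 q, c2 p - c2 q, c3 p - c3 q).
Definition scal3 (a : R) (p : R3) : R3 := (a * c1 p, a * c2 p, a * c3 p).
Definition dot (p q : R3) : R := c1 p * c1 q + c2 p * c2 q + c3 p * c3 q.
Definition cross (p q : R3) : R3 :=
  (c2 p * c3 q - c3 p * c2 q,
   c3 p * c1 q - c1 p * c3 q,
   c1 p * c2 q - c2 p * c1 q).
Definition norm3 (p : R3) : R := sqrt (dot p p).

(* Calculus on S1 is done on the 2 PI-periodic lift t |-> g (angle t). *)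
Definition lift (g : S1 -> R3) : R -> R3 := fun t => g (angle t).

Definition D (k : nat) (f : R -> R3) (t : R) : R3 :=
  (Derive_n (fun u => c1 (f u)) k t,
   Derive_n (fun u => c2 (f u)) k t,
   Derive_n (fun u => c3 (f u)) k t).

Definition C3_fun (h : R -> R) : Prop :=
  (forall (k : nat) (t : R), (k <= 3)%nat -> ex_derive_n h k t) /\
  (forall t : R, continuous (Derive_n h 3) t).

Definition C3 (g : S1 -> R3) : Prop :=
  C3_fun (fun t => c1 (lift g t)) /\
  C3_fun (fun t => c2 (lift g t)) /\
  C3_fun (fun t => c3 (lift g t)).

Definition converges_C3 (g_ : nat -> S1 -> R3) (g : S1 -> R3) : Prop :=
  forall k : nat, (k <= 3)%nat ->
  forall eps : R, 0 < eps ->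
  exists N : nat, forall n : nat, (N <= n)%nat ->
  forall t : R, norm3 (sub3 (D k (lift (g_ n)) t) (D k (lift g) t)) < eps.

Definition speed (f : R -> R3) (t : R) : R := norm3 (D 1 f t).

(* With s the arc length, d/ds = (1 / speed) d/dt; hence the two definitions
   below are the first derivative T and the norm of the second derivative of
   the curve with respect to s. *)
Definition unit_tangent (f : R -> R3) (t : R) : R3 :=
  scal3 (/ speed f t) (D 1 f t).

Definition curvature (f : R -> R3) (t : R) : R :=
  norm3 (scal3 (/ speed f t) (D 1 (unit_tangent f) t)).

(* Junk value (division by zero) where the curvature vanishes. *)
Definition torsion (f : R -> R3) (t : R) : R :=
  dot (cross (D 1 f t) (D 2 f t)) (D 3 f t)
  / (norm3 (cross (D 1 f t) (D 2 f t))) ^ 2.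

Definition image (g : S1 -> R3) (q : R3) : Prop := exists p : S1, g p = q.

Definition in_a_plane (A : R3 -> Prop) : Prop :=
  exists (v : R3) (d : R), v <> (0, 0, 0) /\ forall q : R3, A q -> dot v q = d.

Definition is_a_point (A : R3 -> Prop) : Prop :=
  exists q0 : R3, forall q : R3, A q <-> q = q0.

(* Topological embedding: a homeomorphism onto the image with the subspace
   topology. *)
Definition embedding (g : S1 -> R3) : Prop :=
  (forall p q : S1, g p = g q -> p = q) /\
  (forall V : R3 -> Prop,
     open_R3 V -> open_S1 (fun p => V (g p))) /\
  (forall U : S1 -> Prop, open_S1 U ->
     exists V : R3 -> Prop,
       open_R3 V /\
       forall q : R3,
         (exists p : S1, U p /\ g p = q) <-> (V q /\ image g q)).

(* Main.v *)
From Stdlib Require Import Reals Lra Lia ZArith Classical IndefiniteDescription.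
From Coquelicot Require Import Coquelicot.
Require Import Defs.
Open Scope R_scope.

(** Write V, A, J for the first three derivatives of a curve, W = V x A, and
    B = W / |W| for the binormal.  In an arbitrary parametrization the Frenet
    equations give B' = tau V x B ([binormal_equation]), and since B is a unit
    vector orthogonal to V this inverts to B x B' = tau V.

    The limit curve gamma has constant speed c > 0, because a constant speed
    zero would make it a point.  Being closed it is not straight, so W is nonzero
    at some t0.  There the torsions tau_n converge to the torsion of a plane
    curve, hence tau_n -> 0, and B_n(t0) converges to a unit normal b of the
    plane.  By the equation for B_n', the B_n converge to b locally uniformly
    ([binormal_uconv]).  Two facts about gamma follow.

    - Its signed curvature with respect to b is nonnegative, as the limit of
      B_n . (V_n x A_n) = |W_n| > 0.

    - Its signed area vanishes ([limit_zero_area]).  Rescale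
      beta_n = (B_n - B_n(t0)) / tau_n.  Then beta_n' = V_n x B_n -> V x b, so
      beta_n converges to the curve (gamma - gamma(t0)) x b, a quarter turn of
      gamma.  But B_n x B_n' = tau_n V_n makes beta_n x beta_n' the derivative of
      (gamma_n - B_n(t0) x beta_n) / tau_n, which is periodic.  So the integral of
      beta_n x beta_n' over a period is 0, and in the limit so is the area
      enclosed by gamma.

    It remains to see that a closed plane curve with nonnegative curvature and
    signed area zero meets itself ([zero_area_crossing]).  Its tangent angle th
    is nondecreasing and grows by 2 PI m over a period, with m > 0 because the
    curve closes up.  If m = 1 the curve lies to the left of each of its tangents
    and its area is positive ([one_turn_area_pos]).  If m > 1, compare the
    support function h(phi), the signed distance from the origin to the tangent
    line of angle phi, with its shift h(phi + 2 PI).  The difference sums to zero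
    along phi, phi + 2 PI, ..., phi + 2 PI (m - 1), so it has a zero at which it
    does not decrease.  This gives points s, t one full turn apart that share
    their tangent line, with gamma(t) not behind gamma(s) ([common_tangent]).
    The arc from s to t rises to a top and comes back down to the line, crossing
    itself on the way ([full_turn_crossing]). *)

(** * One-variable calculus *)

Lemma is_derive_val (f : R -> R) (t l l' : R) :
  is_derive f t l -> l = l' -> is_derive f t l'.
Proof. intros H <-; exact H. Qed.

Lemma is_derive_Rext (f g : R -> R) (t l : R) :
  (forall u, f u = g u) -> is_derive f t l -> is_derive g t l.
Proof. exact (is_derive_ext f g t l). Qed.

Lemma is_derive_Rplus (f g : R -> R) (t a b : R) :
  is_derive f t a -> is_derive g t b -> is_derive (fun u => f u + g u) t (a + b).
Proof. intros Hf Hg; exact (is_derive_plus f g t a b Hf Hg). Qed.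

Lemma is_derive_Rminus (f g : R -> R) (t a b : R) :
  is_derive f t a -> is_derive g t b -> is_derive (fun u => f u - g u) t (a - b).
Proof. intros Hf Hg; exact (is_derive_minus f g t a b Hf Hg). Qed.

Lemma is_derive_Rmult (f g : R -> R) (t a b : R) :
  is_derive f t a -> is_derive g t b ->
  is_derive (fun u => f u * g u) t (a * g t + f t * b).
Proof. intros Hf Hg; exact (is_derive_mult f g t a b Hf Hg Rmult_comm). Qed.

Lemma is_derive_Rconst (a t : R) : is_derive (fun _ : R => a) t 0.
Proof. exact (is_derive_const a t). Qed.

Lemma is_derive_Rscal (f : R -> R) (t k a : R) :
  is_derive f t a -> is_derive (fun u => k * f u) t (k * a).
Proof.
intros Hf; apply (is_derive_val _ _ _ _
  (is_derive_Rmult _ _ _ _ _ (is_derive_Rconst k t) Hf)); ring.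
Qed.

Lemma is_derive_shift (f : R -> R) (t a l : R) :
  is_derive f (t + a) l -> is_derive (fun u => f (u + a)) t l.
Proof.
intros Hf; apply (is_derive_val _ _ (1 * l)); [ | ring ].
apply (is_derive_comp f (fun u => u + a) t l 1 Hf).
apply (is_derive_val _ _ (1 + 0)); [ | ring ].
apply is_derive_Rplus; [ exact (is_derive_id t) | apply is_derive_Rconst ].
Qed.

Lemma is_derive_inj (f : R -> R) (t a b : R) :
  is_derive f t a -> is_derive f t b -> a = b.
Proof.
intros Ha Hb; rewrite <- (is_derive_unique _ _ _ Ha).
exact (is_derive_unique _ _ _ Hb).
Qed.

Lemma derivable_continuity (f f' : R -> R) :
  (forall t, is_derive f t (f' t)) -> continuity f.
Proof.
intros Hf t; apply continuity_pt_filterlim.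
apply (ex_derive_continuous f); exists (f' t); apply Hf.
Qed.

Lemma periodic_derive (f f' : R -> R) (p : R) :
  (forall t, is_derive f t (f' t)) -> (forall t, f (t + p) = f t) ->
  forall t, f' (t + p) = f' t.
Proof.
intros Hf Hp t; apply (is_derive_inj f t); [ | apply Hf ].
apply (is_derive_ext (fun u => f (u + p))); [ exact Hp | ].
apply is_derive_shift, Hf.
Qed.

Lemma mean_value (f f' : R -> R) (a b : R) :
  (forall t, is_derive f t (f' t)) -> a <= b ->
  exists w, a <= w <= b /\ f b - f a = f' w * (b - a).
Proof.
intros Hf Hab.
destruct (MVT_gen f a b f') as [w Hw].
- intros; apply Hf.
- intros; apply (derivable_continuity _ _ Hf).
- rewrite Rmin_left, Rmax_right in Hw by lra; exists w; exact Hw.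
Qed.

Lemma derive_lower_bound (f f' : R -> R) (a b m : R) :
  (forall t, is_derive f t (f' t)) -> a <= b ->
  (forall t, a <= t <= b -> m <= f' t) -> m * (b - a) <= f b - f a.
Proof.
intros Hf Hab Hm; destruct (mean_value f f' a b Hf Hab) as [w [Hw ->]].
apply Rmult_le_compat_r; [ lra | auto ].
Qed.

Lemma derive_upper_bound (f f' : R -> R) (a b m : R) :
  (forall t, is_derive f t (f' t)) -> a <= b ->
  (forall t, a <= t <= b -> f' t <= m) -> f b - f a <= m * (b - a).
Proof.
intros Hf Hab Hm; destruct (mean_value f f' a b Hf Hab) as [w [Hw ->]].
apply Rmult_le_compat_r; [ lra | auto ].
Qed.

Lemma derive_zero_const (f : R -> R) :
  (forall t, is_derive f t 0) -> forall s t, f s = f t.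
Proof.
intros Hf.
assert (H : forall s t, s <= t -> f s = f t).
{ intros s t Hst; destruct (mean_value f (fun _ => 0) s t Hf Hst) as [w [_ Hw]].
  lra. }
intros s t; destruct (Rle_dec s t) as [Hst | Hst]; [ auto | symmetry; apply H; lra ].
Qed.

Lemma derive_nonneg_ends_eq (f f' : R -> R) (a b : R) :
  (forall t, is_derive f t (f' t)) ->
  (forall t, a <= t <= b -> 0 <= f' t) -> f a = f b ->
  forall t, a < t < b -> f' t = 0.
Proof.
intros Hf Hp Hab t Ht.
assert (K : forall u, a <= u <= b -> f u = f a).
{ intros u Hu.
  assert (H1 := derive_lower_bound f f' a u 0 Hf ltac:(lra)
                  ltac:(intros; apply Hp; lra)).
  assert (H2 := derive_lower_bound f f' u b 0 Hf ltac:(lra)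
                  ltac:(intros; apply Hp; lra)).
  lra. }
apply (is_derive_inj f t); [ apply Hf | ].
apply (is_derive_ext_loc (fun _ => f a)); [ | apply is_derive_Rconst ].
assert (Hd : 0 < Rmin (t - a) (b - t)) by (apply Rmin_pos; lra).
exists (mkposreal _ Hd); intros u Hu.
change (Rabs (u - t) < Rmin (t - a) (b - t)) in Hu.
symmetry; apply K.
generalize (Rmin_l (t - a) (b - t)), (Rmin_r (t - a) (b - t)); intros.
apply Rabs_def2 in Hu; lra.
Qed.

Lemma continuous_primitive (g : R -> R) (a : R) :
  continuity g -> exists f, f a = 0 /\ forall t, is_derive f t (g t).
Proof.
intros Hg; exists (RInt g a); split; [ exact (RInt_point a g) | ].
assert (Hc : forall t, continuous g t)
  by (intros t; apply continuity_pt_filterlim, Hg).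
intros t; apply is_derive_RInt with a; [ | apply Hc ].
apply filter_forall; intros u; apply (@RInt_correct R_CompleteNormedModule).
apply (@ex_RInt_continuous R_CompleteNormedModule); intros; apply Hc.
Qed.

Lemma IVT_between (f : R -> R) (a b y : R) :
  continuity f -> a <= b -> (f a <= y <= f b \/ f b <= y <= f a) ->
  exists x, a <= x <= b /\ f x = y.
Proof.
intros Hf Hab Hy.
destruct (IVT_gen f a b y Hf) as [x [Hx E]].
- destruct Hy as [Hy | Hy].
  + rewrite Rmin_left, Rmax_right by lra; exact Hy.
  + rewrite Rmin_right, Rmax_left by lra; exact Hy.
- rewrite Rmin_left, Rmax_right in Hx by lra; exists x; auto.
Qed.

Lemma continuity_eps (f : R -> R) (t eps : R) :
  continuity f -> 0 < eps ->
  exists d, 0 < d /\ forall u, Rabs (u - t) < d -> Rabs (f u - f t) < eps.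
Proof.
intros Hf He; destruct (Hf t eps He) as [d [Hd H]]; exists d; split; [ exact Hd | ].
intros u Hu; destruct (Req_dec u t) as [-> | Hne].
- rewrite Rminus_diag, Rabs_R0; exact He.
- apply (H u); repeat split; auto.
Qed.

Lemma first_zero (g : R -> R) (a b : R) :
  continuity g -> a <= b -> g a < 0 -> 0 <= g b ->
  exists z, a < z <= b /\ g z = 0 /\ forall t, a <= t < z -> g t < 0.
Proof.
intros Hg Hab Ha Hb.
set (E := fun t => a <= t <= b /\ forall u, a <= u <= t -> g u < 0).
assert (Ea : E a).
{ split; [ lra | intros u Hu; replace u with a by lra; exact Ha ]. }
destruct (completeness E) as [z [Hz1 Hz2]].
- exists b; intros t [Ht _]; lra.
- exists a; exact Ea.
- assert (Haz : a <= z) by (apply Hz1, Ea).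
  assert (Hzb : z <= b) by (apply Hz2; intros t [Ht _]; lra).
  assert (Hbelow : forall t, a <= t < z -> g t < 0).
  { intros t Ht; apply NNPP; intros Hn.
    assert (z <= t); [ | lra ].
    apply Hz2; intros e [He He']; apply Rnot_lt_le; intros Hlt.
    apply Hn, He'; lra. }
  assert (Hz0 : g z = 0).
  { destruct (Rtotal_order (g z) 0) as [Hneg | [E0 | Hpos]]; [ | exact E0 | ].
    - destruct (continuity_eps g z (- g z) Hg ltac:(lra)) as [d [Hd H]].
      assert (Hzb' : z < b) by (apply Rnot_le_lt; intros ?; assert (z = b) by lra;
                                subst z; lra).
      set (w := Rmin b (z + d / 2)).
      assert (Hw : z < w <= b /\ w <= z + d / 2).
      { unfold w; generalize (Rmin_l b (z + d / 2)), (Rmin_r b (z + d / 2)).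
        intros; repeat split; try lra; apply Rmin_glb_lt; lra. }
      assert (E w); [ | assert (w <= z) by (apply Hz1; assumption); lra ].
      split; [ lra | intros u Hu ].
      destruct (Rlt_dec u z) as [Hu' | Hu']; [ apply Hbelow; lra | ].
      assert (Hu2 := H u ltac:(rewrite Rabs_right; lra)).
      apply Rabs_def2 in Hu2; lra.
    - destruct (continuity_eps g z (g z) Hg Hpos) as [d [Hd H]].
      assert (Haz' : a < z) by (apply Rnot_le_lt; intros ?; assert (z = a) by lra;
                                subst z; lra).
      set (w := Rmax a (z - d / 2)).
      assert (Hw : a <= w < z /\ z - d / 2 <= w).
      { unfold w; generalize (Rmax_l a (z - d / 2)), (Rmax_r a (z - d / 2)).
        intros; repeat split; try lra; apply Rmax_lub_lt; lra. }
      assert (Hu1 := H w ltac:(rewrite Rabs_left; lra)).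
      apply Rabs_def2 in Hu1.
      assert (g w < 0) by (apply Hbelow; lra); lra. }
  exists z; repeat split; auto.
  apply Rnot_le_lt; intros ?; assert (z = a) by lra; subst z; lra.
Qed.

Lemma bounded_cluster_point (u : nat -> R) (a b : R) :
  (forall n, a <= u n <= b) ->
  exists l, a <= l <= b /\
    forall eps N, 0 < eps -> exists n, (N <= n)%nat /\ Rabs (u n - l) < eps.
Proof.
intros Hu.
destruct (Bolzano_Weierstrass u _ (compact_P3 a b) Hu) as [l Hl].
assert (K : forall eps N, 0 < eps ->
              exists n, (N <= n)%nat /\ Rabs (u n - l) < eps).
{ intros eps N He; apply (Hl (fun x => Rabs (x - l) < eps)).
  exists (mkposreal eps He); intros x Hx; exact Hx. }
exists l; split; [ | exact K ].
split; apply Rnot_lt_le; intros Hlt.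
- destruct (K (a - l) 0%nat ltac:(lra)) as [n [_ Hn]].
  apply Rabs_def2 in Hn; specialize (Hu n); lra.
- destruct (K (l - b) 0%nat ltac:(lra)) as [n [_ Hn]].
  apply Rabs_def2 in Hn; specialize (Hu n); lra.
Qed.

Lemma eps_continuity (f : R -> R) :
  (forall t eps, 0 < eps ->
     exists d, 0 < d /\ forall u, Rabs (u - t) < d -> Rabs (f u - f t) < eps) ->
  continuity f.
Proof.
intros H t eps He; destruct (H t eps He) as [d [Hd K]].
exists d; split; [ exact Hd | ]; intros u [_ Hu]; exact (K u Hu).
Qed.

Lemma continuity_bounded (f : R -> R) (a b : R) :
  continuity f -> exists M, 0 < M /\ forall t, a <= t <= b -> Rabs (f t) <= M.
Proof.
intros Hf; destruct (Rle_dec a b) as [Hab | Hab];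
  [ | exists 1; split; [ lra | intros; lra ] ].
assert (C := fun t (_ : a <= t <= b) => Hf t).
destruct (continuity_ab_maj f a b Hab C) as [p [Hp _]].
destruct (continuity_ab_min f a b Hab C) as [q [Hq _]].
exists (Rabs (f p) + Rabs (f q) + 1).
generalize (Rabs_pos (f p)), (Rabs_pos (f q)); intros; split; [ lra | ].
intros t Ht; specialize (Hp t Ht); specialize (Hq t Ht).
generalize (Rle_abs (f p)), (Rabs_maj2 (f q)); intros; apply Rabs_le; lra.
Qed.

(** * Crossing of two monotone strands *)

(** Compactness of the set of pairs (u, v) at equal height: heights and sides
    survive the limit v -> v0, the points u only along a subsequence.  The sign
    of the factor [k] chooses the side. *)
Lemma level_limit (x y : R -> R) (k a b v0 : R) :
  continuity x -> continuity y ->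
  (forall eps, 0 < eps -> exists u v,
     a <= u <= b /\ Rabs (v - v0) < eps /\ y u = y v /\ 0 <= k * (x u - x v)) ->
  exists u, a <= u <= b /\ y u = y v0 /\ 0 <= k * (x u - x v0).
Proof.
intros Hx Hy H.
assert (H' : forall n : nat, exists uv : R * R,
  a <= fst uv <= b /\ Rabs (snd uv - v0) < / (INR n + 1) /\
  y (fst uv) = y (snd uv) /\ 0 <= k * (x (fst uv) - x (snd uv))).
{ intros n; destruct (H (/ (INR n + 1))) as [u [v Huv]].
  - apply Rinv_0_lt_compat; generalize (pos_INR n); lra.
  - exists (u, v); exact Huv. }
destruct (functional_choice _ H') as [p Hp].
destruct (bounded_cluster_point (fun n => fst (p n)) a b) as [l [Hl Hc]];
  [ intros n; apply Hp | ].
assert (K : forall eps, 0 < eps -> exists u v,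
  Rabs (u - l) < eps /\ Rabs (v - v0) < eps /\ y u = y v /\ 0 <= k * (x u - x v)).
{ intros eps He; destruct (archimed_cor1 eps He) as [N [HN HN0]].
  destruct (Hc eps N He) as [n [Hn Hd]].
  exists (fst (p n)), (snd (p n)).
  destruct (Hp n) as [_ [Hv Hr]]; split; [ exact Hd | split; [ | exact Hr ] ].
  apply Rlt_trans with (1 := Hv), Rle_lt_trans with (/ INR N); [ | exact HN ].
  apply lt_INR in HN0; change (INR 0) with 0 in HN0; apply le_INR in Hn.
  apply Rinv_le_contravar; lra. }
exists l; split; [ exact Hl | split ].
- apply cond_eq; intros eps He.
  destruct (continuity_eps y l (eps / 2) Hy ltac:(lra)) as [d1 [Hd1 H1]].
  destruct (continuity_eps y v0 (eps / 2) Hy ltac:(lra)) as [d2 [Hd2 H2]].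
  destruct (K (Rmin d1 d2) ltac:(apply Rmin_pos; lra)) as [u [v [Hu [Hv [E _]]]]].
  specialize (H1 u ltac:(generalize (Rmin_l d1 d2); lra)).
  specialize (H2 v ltac:(generalize (Rmin_r d1 d2); lra)).
  apply Rabs_def2 in H1; apply Rabs_def2 in H2; apply Rabs_def1; lra.
- apply Rnot_lt_le; intros Hneg.
  assert (Hkp : 0 < Rabs k + 1) by (generalize (Rabs_pos k); lra).
  set (e := - (k * (x l - x v0)) / (2 * (Rabs k + 1))).
  assert (He : 0 < e) by (apply Rdiv_lt_0_compat; lra).
  destruct (continuity_eps x l e Hx He) as [d1 [Hd1 H1]].
  destruct (continuity_eps x v0 e Hx He) as [d2 [Hd2 H2]].
  destruct (K (Rmin d1 d2) ltac:(apply Rmin_pos; lra)) as [u [v [Hu [Hv [_ E]]]]].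
  specialize (H1 u ltac:(generalize (Rmin_l d1 d2); lra)).
  specialize (H2 v ltac:(generalize (Rmin_r d1 d2); lra)).
  assert (H3 : Rabs k * Rabs ((x u - x l) - (x v - x v0)) <= Rabs k * (2 * e)).
  { apply Rmult_le_compat_l; [ apply Rabs_pos | ].
    apply Rabs_def2 in H1; apply Rabs_def2 in H2; apply Rabs_le; lra. }
  rewrite <- Rabs_mult in H3.
  assert (H4 := Rle_abs (k * ((x u - x l) - (x v - x v0)))).
  assert (H5 : 2 * e * (Rabs k + 1) = - (k * (x l - x v0))).
  { unfold e; field; lra. }
  nra.
Qed.

(** Move down the second strand and let [v0] be the last parameter at which the
    first strand has, at the same height, a point weakly to the right.  By
    compactness there is such a point at [v0] itself, and, coming from below, also
    one weakly to the left.  Both lie at the same height, so by monotonicity the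
    first strand is level between them, and it passes through the point of the
    second strand. *)
Lemma strands_cross (x y : R -> R) (s b b' t : R) :
  continuity x -> continuity y -> s <= b -> b' <= t ->
  (forall u v, s <= u -> u <= v -> v <= b -> y u <= y v) ->
  (forall u v, b' <= u -> u <= v -> v <= t -> y v <= y u) ->
  y s = y t -> y b = y b' -> x s <= x t -> x b' <= x b ->
  exists u v, s <= u <= b /\ b' <= v <= t /\ x u = x v /\ y u = y v.
Proof.
intros Hx Hy Hsb Hbt Hup Hdown Es Eb Xs Xb.
set (S := fun v => b' <= v <= t /\ exists u, s <= u <= b /\ y u = y v /\ x v <= x u).
assert (Sb : S b') by (split; [ lra | exists b; repeat split; auto; lra ]).
destruct (completeness S) as [v0 [Hv1 Hv2]].
{ exists t; intros v [Hv _]; lra. }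
{ exists b'; exact Sb. }
assert (Hb'v : b' <= v0) by (apply Hv1, Sb).
assert (Hvt : v0 <= t) by (apply Hv2; intros v [Hv _]; lra).
destruct (level_limit x y 1 s b v0 Hx Hy) as [u0 [Hu0 [Yu0 Xu0]]].
{ intros eps He; apply NNPP; intros Hn.
  assert (v0 <= v0 - eps / 2); [ | lra ].
  apply Hv2; intros v [Hv [u [Hu [Yu Xu]]]]; apply Rnot_lt_le; intros Hlt.
  apply Hn; exists u, v; repeat split; try lra.
  assert (v <= v0) by (apply Hv1; split; [ exact Hv | exists u; auto ]).
  apply Rabs_def1; lra. }
assert (H1 : exists u1, s <= u1 <= b /\ y u1 = y v0 /\ x u1 <= x v0).
{ destruct (Req_dec v0 t) as [-> | Hne].
  - exists s; repeat split; lra.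
  - destruct (level_limit x y (-1) s b v0 Hx Hy) as [u1 [Hu1 [Yu1 Xu1]]].
    + intros eps He.
      set (v := Rmin t (v0 + eps / 2)).
      assert (Hv : v0 < v <= t /\ v <= v0 + eps / 2).
      { unfold v; generalize (Rmin_l t (v0 + eps / 2)), (Rmin_r t (v0 + eps / 2)).
        intros; repeat split; try lra; apply Rmin_glb_lt; lra. }
      destruct (IVT_between y s b (y v) Hy Hsb) as [u [Hu Yu]].
      { left; split.
        - rewrite Es; apply Hdown; lra.
        - rewrite Eb; apply Hdown; lra. }
      exists u, v; repeat split; try lra; [ apply Rabs_def1; lra | ].
      apply Rnot_lt_le; intros Hlt.
      assert (v <= v0); [ | lra ].
      apply Hv1; split; [ lra | exists u; repeat split; lra ].
    + exists u1; repeat split; lra. }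
destruct H1 as [u1 [Hu1 [Yu1 Xu1]]].
assert (H2 : exists u, Rmin u0 u1 <= u <= Rmax u0 u1 /\ x u = x v0).
{ destruct (IVT_gen x u0 u1 (x v0) Hx) as [u Hu]; [ | exists u; exact Hu ].
  split.
  - apply Rle_trans with (1 := Rmin_r _ _), Xu1.
  - apply Rle_trans with (2 := Rmax_l _ _); lra. }
destruct H2 as [u [Hu Xu]].
assert (Hr : s <= Rmin u0 u1 /\ Rmax u0 u1 <= b)
  by (split; [ apply Rmin_glb | apply Rmax_lub ]; lra).
exists u, v0; repeat split; try lra.
apply Rle_antisym.
- apply Rle_trans with (y (Rmax u0 u1)); [ apply Hup; lra | ].
  unfold Rmax; destruct (Rle_dec u0 u1); lra.
- apply Rle_trans with (y (Rmin u0 u1)); [ | apply Hup; lra ].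
  unfold Rmin; destruct (Rle_dec u0 u1); lra.
Qed.

(** * Locally convex plane curves *)

(** [th] is the tangent angle.  Convexity is its monotonicity, so that straight
    pieces are allowed and second derivatives do not enter. *)
Record convex_arc (c : R) (x y th : R -> R) : Prop := {
  arc_speed : 0 < c;
  arc_dx : forall t, is_derive x t (c * cos (th t));
  arc_dy : forall t, is_derive y t (c * sin (th t));
  arc_cont : continuity th;
  arc_mono : forall s t, s <= t -> th s <= th t
}.

Lemma arc_lt (c : R) (x y th : R -> R) (s t : R) :
  convex_arc c x y th -> th s < th t -> s < t.
Proof.
intros H Hst; apply Rnot_le_lt; intros Hts.
generalize (arc_mono _ _ _ _ H _ _ Hts); lra.
Qed.

Lemma convex_arc_rotate (c : R) (x y th : R -> R) (phi : R) :
  convex_arc c x y th ->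
  convex_arc c (fun t => cos phi * x t + sin phi * y t)
               (fun t => cos phi * y t - sin phi * x t)
               (fun t => th t - phi).
Proof.
intros [Hc Hx Hy Ht Hm]; split; auto.
- intros t; eapply is_derive_val;
    [ apply is_derive_Rplus; apply is_derive_Rscal; [ apply Hx | apply Hy ] | ].
  rewrite cos_minus; ring.
- intros t; eapply is_derive_val;
    [ apply is_derive_Rminus; apply is_derive_Rscal; [ apply Hy | apply Hx ] | ].
  rewrite sin_minus; ring.
- apply (continuity_minus th (fun _ => phi)); [ exact Ht | ].
  apply continuity_const; intros ? ?; reflexivity.
- intros s t Hst; generalize (Hm s t Hst); lra.
Qed.

Lemma cos_le_quarter (a : R) : 3 * PI / 4 <= a <= 5 * PI / 4 -> cos a < 0.
Proof.
intros Ha; generalize PI_RGT_0; intros HP; apply cos_lt_0; lra.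
Qed.

(** The arc rises while [th] is in [0, PI] and falls while it is in [PI, 2 PI].
    Just below the top the rising strand is to the right of the falling one; at
    the bottom line it starts at or to the left of the end of the arc.  So the two
    strands cross. *)
Lemma full_turn_crossing (c : R) (x y th : R -> R) (s t : R) :
  convex_arc c x y th -> th s = 0 -> th t = 2 * PI ->
  y s = y t -> x s <= x t ->
  exists u v, s <= u /\ u < v /\ v <= t /\ x u = x v /\ y u = y v.
Proof.
intros H Hs Ht Hy Hx.
assert (HP := PI_RGT_0).
destruct (H) as [Hc Dx Dy Ct Mt].
assert (Cx := derivable_continuity _ _ Dx).
assert (Cy := derivable_continuity _ _ Dy).
assert (Hst : s < t) by (apply (arc_lt _ _ _ _ _ _ H); lra).
assert (Hang : forall a, 0 <= a <= 2 * PI -> exists w, s <= w <= t /\ th w = a).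
{ intros a Ha; apply IVT_between; auto; lra. }
destruct (Hang PI ltac:(lra)) as [a [Ha Ta]].
destruct (Hang (3 * PI / 4) ltac:(lra)) as [a1 [Ha1 Ta1]].
destruct (Hang (5 * PI / 4) ltac:(lra)) as [a2 [Ha2 Ta2]].
assert (L1 : a1 < a) by (apply (arc_lt _ _ _ _ _ _ H); lra).
assert (L2 : a < a2) by (apply (arc_lt _ _ _ _ _ _ H); lra).
assert (Up : forall u v, s <= u -> u <= v -> v <= a -> y u <= y v).
{ intros u v Hu Huv Hv.
  assert (K := derive_lower_bound y _ u v 0 Dy Huv); cbv beta in K.
  rewrite Rmult_0_l in K.
  enough (0 <= y v - y u) by lra; apply K; intros w Hw.
  apply Rmult_le_pos; [ lra | ]; apply sin_ge_0.
  - rewrite <- Hs; apply Mt; lra.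
  - rewrite <- Ta; apply Mt; lra. }
assert (Down : forall u v, a <= u -> u <= v -> v <= t -> y v <= y u).
{ intros u v Hu Huv Hv.
  assert (K := derive_upper_bound y _ u v 0 Dy Huv); cbv beta in K.
  rewrite Rmult_0_l in K.
  enough (y v - y u <= 0) by lra; apply K; intros w Hw.
  assert (th w <= 2 * PI) by (rewrite <- Ht; apply Mt; lra).
  assert (PI <= th w) by (rewrite <- Ta; apply Mt; lra).
  assert (sin (th w) <= 0) by (apply sin_le_0; lra).
  nra. }
assert (Left : forall u v, a1 <= u -> u <= v -> v <= a2 -> x v <= x u).
{ intros u v Hu Huv Hv.
  assert (K := derive_upper_bound x _ u v 0 Dx Huv); cbv beta in K.
  rewrite Rmult_0_l in K.
  enough (x v - x u <= 0) by lra; apply K; intros w Hw.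
  assert (th w <= 5 * PI / 4) by (rewrite <- Ta2; apply Mt; lra).
  assert (3 * PI / 4 <= th w) by (rewrite <- Ta1; apply Mt; lra).
  assert (cos (th w) < 0) by (apply cos_le_quarter; lra).
  nra. }
(* Truncating the arc just below its top makes the two strands disjoint. *)
assert (Top : exists b b', a1 <= b <= a /\ a <= b' <= a2 /\ b < b' /\ y b = y b').
{ destruct (Rle_dec (y a1) (y a2)) as [Hle | Hgt].
  - destruct (IVT_between y a1 a (y a2) Cy ltac:(lra)) as [u [Hu Yu]].
    + left; split; [ exact Hle | apply Down; lra ].
    + exists u, a2; repeat split; lra.
  - destruct (IVT_between y a a2 (y a1) Cy ltac:(lra)) as [v [Hv Yv]].
    + right; split; [ lra | apply Up; lra ].
    + exists a1, v; repeat split; lra. }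
destruct Top as [b [b' [Hb [Hb' [Hbb Yb]]]]].
destruct (strands_cross x y s b b' t Cx Cy) as [u [v [Hu [Hv E]]]]; try lra.
- intros; apply Up; lra.
- intros; apply Down; lra.
- apply Left; lra.
- exists u, v; repeat split; try lra; apply E.
Qed.

(** Signed distance from the origin to the line of direction angle [phi] through
    the point [(x, y)]; it grows when that line moves to its right. *)
Definition support (x y phi : R) : R := x * sin phi - y * cos phi.

Lemma is_derive_support (c : R) (x y th : R -> R) (phi t : R) :
  convex_arc c x y th ->
  is_derive (fun w => support (x w) (y w) phi) t (c * sin (phi - th t)).
Proof.
intros [Hc Hx Hy _ _]; unfold support.
apply (is_derive_Rext (fun w => sin phi * x w - cos phi * y w)).
{ intros; ring. }
eapply is_derive_val;
  [ apply is_derive_Rminus; apply is_derive_Rscal; [ apply Hx | apply Hy ] | ].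
rewrite sin_minus; ring.
Qed.

(** The derivative of the support value in the direction [th s] at the parameter
    [w] is [c * sin (th s - th w)], whose sign is known as long as the arc turns
    by at most PI on either side of [s]. *)
Lemma arc_left_of_tangent (c : R) (x y th : R -> R) (s u : R) :
  convex_arc c x y th -> Rabs (th u - th s) <= PI ->
  support (x u) (y u) (th s) <= support (x s) (y s) (th s).
Proof.
intros H Hus; apply Rabs_le_between in Hus.
assert (Hc := arc_speed _ _ _ _ H).
assert (D := fun t => is_derive_support c x y th (th s) t H).
assert (Mt := arc_mono _ _ _ _ H).
destruct (Rle_dec s u) as [Hsu | Hsu].
- assert (K := derive_upper_bound _ _ s u 0 D Hsu); cbv beta in K.
  rewrite Rmult_0_l in K.
  enough (support (x u) (y u) (th s) - support (x s) (y s) (th s) <= 0) by lra.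
  apply K; intros w Hw.
  assert (th s <= th w) by (apply Mt; lra).
  assert (th w <= th u) by (apply Mt; lra).
  assert (0 <= sin (th w - th s)) by (apply sin_ge_0; lra).
  replace (th s - th w) with (- (th w - th s)) by ring; rewrite sin_neg; nra.
- assert (K := derive_lower_bound _ _ u s 0 D ltac:(lra)); cbv beta in K.
  rewrite Rmult_0_l in K.
  enough (0 <= support (x s) (y s) (th s) - support (x u) (y u) (th s)) by lra.
  apply K; intros w Hw.
  assert (th w <= th s) by (apply Mt; lra).
  assert (th u <= th w) by (apply Mt; lra).
  assert (0 <= sin (th s - th w)) by (apply sin_ge_0; lra); nra.
Qed.

(** * Closed locally convex curves *)

(** [m] is the rotation index. *)
Record convex_loop (c : R) (m : nat) (x y th : R -> R) : Prop := {
  loop_arc : convex_arc c x y th;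
  loop_x : forall t, x (t + 2 * PI) = x t;
  loop_y : forall t, y (t + 2 * PI) = y t;
  loop_th : forall t, th (t + 2 * PI) = th t + 2 * INR m * PI;
  loop_turns : (0 < m)%nat
}.

Lemma loop_angle_onto (c : R) (m : nat) (x y th : R -> R) :
  convex_loop c m x y th -> forall phi, exists s, th s = phi.
Proof.
intros [H _ _ Ht Hm] phi.
assert (HP := PI_RGT_0).
assert (Hm1 : 1 <= INR m) by (change 1 with (INR 1); apply le_INR; lia).
assert (It : forall k t, th (t + 2 * INR k * PI) = th t + 2 * INR k * (INR m * PI)).
{ induction k as [ | k IH]; intros t.
  - change (INR 0) with 0.
    replace (t + 2 * 0 * PI) with t by ring; ring.
  - rewrite S_INR.
    replace (t + 2 * (INR k + 1) * PI) with ((t + 2 * INR k * PI) + 2 * PI) by ring.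
    rewrite Ht, IH; ring. }
destruct (INR_unbounded (Rabs (phi - th 0) / PI)) as [k Hk].
assert (Hk' : Rabs (phi - th 0) < INR k * PI).
{ apply Rmult_lt_compat_r with (r := PI) in Hk; [ | lra ].
  unfold Rdiv in Hk; rewrite Rmult_assoc, Rinv_l, Rmult_1_r in Hk; lra. }
assert (Hk0 := pos_INR k).
assert (P1 := It k 0).
assert (P2 := It k (- (2 * INR k * PI))).
replace (- (2 * INR k * PI) + 2 * INR k * PI) with 0 in P2 by ring.
assert (Hkm : INR k * PI <= INR k * (INR m * PI)).
{ apply Rmult_le_compat_l; [ lra | ]; nra. }
apply Rabs_def2 in Hk'.
destruct (IVT_between th (- (2 * INR k * PI)) (0 + 2 * INR k * PI) phi) as [s [_ Hs]].
- apply (arc_cont _ _ _ _ H).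
- nra.
- left; lra.
- exists s; exact Hs.
Qed.

(** Every point of the loop is within an angle PI of [t0] or of [t0 + 2 * PI],
    which are the same point of the plane.  So that point is to the left of all
    tangents, and the area swept from it grows.  Were the total zero, every
    tangent would pass through that point; but after a quarter turn the distance
    from the point to the tangent is the integral of a nonnegative sine that is not
    identically zero. *)
Lemma one_turn_area_pos (c : R) (x y th a : R -> R) (t0 : R) :
  convex_loop c 1 x y th ->
  (forall t, is_derive a t
     ((x t - x t0) * (c * sin (th t)) - (y t - y t0) * (c * cos (th t)))) ->
  a t0 <> a (t0 + 2 * PI).
Proof.
intros L Da Ea.
assert (HP := PI_RGT_0).
destruct (L) as [H Px Py Pt _].
assert (Hc := arc_speed _ _ _ _ H).
assert (Mt := arc_mono _ _ _ _ H).
assert (Pt0 := Pt t0); change (INR 1) with 1 in Pt0.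
assert (F : forall t, (x t - x t0) * (c * sin (th t)) - (y t - y t0) * (c * cos (th t))
  = c * (support (x t) (y t) (th t) - support (x t0) (y t0) (th t)))
  by (intros; unfold support; ring).
assert (Z : forall t, t0 < t < t0 + 2 * PI ->
  support (x t) (y t) (th t) = support (x t0) (y t0) (th t)).
{ intros t Ht.
  assert (K := derive_nonneg_ends_eq a _ t0 (t0 + 2 * PI) Da); cbv beta in K.
  specialize (fun p => K p Ea t Ht).
  rewrite F in K; destruct (Rmult_integral c _ (K ltac:(
    intros w Hw; rewrite F; apply Rmult_le_pos; [ lra | ];
    assert (th t0 <= th w) by (apply Mt; lra);
    assert (th w <= th (t0 + 2 * PI)) by (apply Mt; lra);
    destruct (Rle_dec (th w) (th t0 + PI));
    [ generalize (arc_left_of_tangent c x y th w t0 H ltac:(apply Rabs_le; lra)); lra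
    | generalize (arc_left_of_tangent c x y th w (t0 + 2 * PI) H
                    ltac:(apply Rabs_le; lra));
      rewrite Px, Py; lra ]))); lra. }
destruct (loop_angle_onto _ _ _ _ _ L (th t0 + PI / 2)) as [t Ht].
destruct (loop_angle_onto _ _ _ _ _ L (th t0 + PI / 4)) as [w Hw].
assert (t0 < w) by (apply (arc_lt _ _ _ _ _ _ H); lra).
assert (w < t) by (apply (arc_lt _ _ _ _ _ _ H); lra).
assert (t < t0 + 2 * PI) by (apply (arc_lt _ _ _ _ _ _ H); lra).
assert (K := derive_nonneg_ends_eq _ _ t0 t
  (fun u => is_derive_support c x y th (th t) u H)); cbv beta in K.
assert (K0 : c * sin (th t - th w) = 0).
{ apply K; [ | symmetry; apply Z; lra | lra ].
  intros u Hu; apply Rmult_le_pos; [ lra | apply sin_ge_0 ].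
  - generalize (Mt u t ltac:(lra)); lra.
  - generalize (Mt t0 u ltac:(lra)); lra. }
assert (0 < sin (th t - th w)) by (apply sin_gt_0; lra).
nra.
Qed.

(** The tangent line depends on its angle only, although the point of contact
    does not when the curve has straight pieces.  The function [h] is continuous
    because it is locally the maximum of the support values over a bounded arc. *)
Lemma support_function (c : R) (m : nat) (x y th : R -> R) :
  convex_loop c m x y th ->
  exists h, continuity h /\
    (forall phi, h (phi + 2 * INR m * PI) = h phi) /\
    (forall s, h (th s) = support (x s) (y s) (th s)) /\
    (forall phi u, Rabs (th u - phi) <= PI -> support (x u) (y u) phi <= h phi).
Proof.
intros L; assert (HP := PI_RGT_0).
destruct (L) as [H Px Py Pt _].
destruct (functional_choice _ (loop_angle_onto _ _ _ _ _ L)) as [sg Hsg].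
pose (h := fun phi => support (x (sg phi)) (y (sg phi)) phi).
assert (Hup : forall phi u, Rabs (th u - phi) <= PI -> support (x u) (y u) phi <= h phi).
{ intros phi u Hu; unfold h.
  generalize (arc_left_of_tangent c x y th (sg phi) u H); rewrite Hsg; auto. }
assert (Heq : forall s, h (th s) = support (x s) (y s) (th s)).
{ intros s; apply Rle_antisym.
  - unfold h; apply (arc_left_of_tangent c x y th s (sg (th s)) H).
    rewrite Hsg, Rminus_diag, Rabs_R0; lra.
  - apply Hup; rewrite Rminus_diag, Rabs_R0; lra. }
exists h; repeat split; auto.
- apply eps_continuity; intros phi eps He.
  assert (Cx := derivable_continuity _ _ (arc_dx _ _ _ _ H)).
  assert (Cy := derivable_continuity _ _ (arc_dy _ _ _ _ H)).
  destruct (continuity_bounded x (sg (phi - 2)) (sg (phi + 2)) Cx) as [M [HM Bx]].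
  destruct (continuity_bounded y (sg (phi - 2)) (sg (phi + 2)) Cy) as [M' [HM' By]].
  set (e := eps / (M + M')).
  assert (He' : 0 < e) by (apply Rdiv_lt_0_compat; lra).
  assert (Ee : M * e + M' * e = eps) by (unfold e; field; lra).
  destruct (continuity_eps sin phi e continuity_sin He') as [d1 [Hd1 D1]].
  destruct (continuity_eps cos phi e continuity_cos He') as [d2 [Hd2 D2]].
  assert (Loc : forall a, Rabs (a - phi) < 1 ->
                Rabs (x (sg a)) <= M /\ Rabs (y (sg a)) <= M').
  { intros a Ha; apply Rabs_def2 in Ha.
    assert (sg (phi - 2) <= sg a <= sg (phi + 2)).
    { split; left; apply (arc_lt _ _ _ _ _ _ H); rewrite !Hsg; lra. }
    split; [ apply Bx | apply By ]; assumption. }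
  assert (Lip : forall a psi, Rabs (a - phi) < 1 -> Rabs (psi - phi) < d1 ->
    Rabs (psi - phi) < d2 ->
    Rabs (support (x (sg a)) (y (sg a)) psi - support (x (sg a)) (y (sg a)) phi) < eps).
  { intros a psi Ha H1 H2; destruct (Loc a Ha) as [Bxa Bya].
    specialize (D1 psi H1); specialize (D2 psi H2).
    unfold support.
    replace (x (sg a) * sin psi - y (sg a) * cos psi -
             (x (sg a) * sin phi - y (sg a) * cos phi))
      with (x (sg a) * (sin psi - sin phi) - y (sg a) * (cos psi - cos phi)) by ring.
    apply Rle_lt_trans with (1 := Rabs_triang _ _).
    rewrite Rabs_Ropp, !Rabs_mult, <- Ee.
    apply Rplus_lt_compat.
    - apply Rle_lt_trans with (M * Rabs (sin psi - sin phi)).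
      + apply Rmult_le_compat_r; [ apply Rabs_pos | exact Bxa ].
      + apply Rmult_lt_compat_l; assumption.
    - apply Rle_lt_trans with (M' * Rabs (cos psi - cos phi)).
      + apply Rmult_le_compat_r; [ apply Rabs_pos | exact Bya ].
      + apply Rmult_lt_compat_l; assumption. }
  set (d := Rmin 1 (Rmin d1 d2)).
  assert (Hd : 0 < d) by (repeat apply Rmin_pos; lra).
  exists d; split; [ exact Hd | ]; intros psi Hpsi.
  assert (d <= 1 /\ d <= d1 /\ d <= d2).
  { unfold d; generalize (Rmin_l 1 (Rmin d1 d2)), (Rmin_r 1 (Rmin d1 d2)),
      (Rmin_l d1 d2), (Rmin_r d1 d2); lra. }
  assert (K1 := Lip phi psi ltac:(rewrite Rminus_diag, Rabs_R0; lra)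
                  ltac:(lra) ltac:(lra)).
  assert (K2 := Lip psi psi ltac:(lra) ltac:(lra) ltac:(lra)).
  assert (H1 := Hup psi (sg phi)); rewrite Hsg, Rabs_minus_sym in H1.
  specialize (H1 ltac:(generalize PI2_1; lra)).
  assert (H2 := Hup phi (sg psi)); rewrite Hsg in H2.
  specialize (H2 ltac:(generalize PI2_1; lra)).
  apply Rabs_def2 in K1; apply Rabs_def2 in K2.
  unfold h in *; apply Rabs_def1; lra.
- intros phi; rewrite <- (Hsg phi), <- Pt, !Heq, Px, Py.
  unfold support; rewrite Pt, sin_period, cos_period; reflexivity.
Qed.

(** The [m] increments between [a] and [a + 2 * INR m * PI] are nonnegative and
    add up to zero. *)
Lemma periodic_monotone_shift (h : R -> R) (m : nat) :
  (0 < m)%nat -> (forall a, h (a + 2 * INR m * PI) = h a) ->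
  (forall a, h a <= h (a + 2 * PI)) -> forall a, h (a + 2 * PI) = h a.
Proof.
intros Hm Hp Hle a; apply Rle_antisym; [ | apply Hle ].
assert (It : forall k b, h b <= h (b + 2 * INR k * PI)).
{ induction k as [ | k IH]; intros b.
  - change (INR 0) with 0; replace (b + 2 * 0 * PI) with b by ring; lra.
  - rewrite S_INR.
    replace (b + 2 * (INR k + 1) * PI) with ((b + 2 * INR k * PI) + 2 * PI) by ring.
    apply Rle_trans with (1 := IH b), Hle. }
destruct m as [ | m]; [ lia | ].
rewrite <- (Hp a), S_INR.
replace (a + 2 * (INR m + 1) * PI) with (a + 2 * PI + 2 * INR m * PI) by ring.
apply It.
Qed.

(** The difference between [h] and its shift is periodic and takes both signs
    unless it vanishes.  Its first zero after a negative value is the point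
    sought. *)
Lemma shift_upcrossing (h : R -> R) (m : nat) :
  continuity h -> (0 < m)%nat -> (forall a, h (a + 2 * INR m * PI) = h a) ->
  exists a b, b - PI / 2 <= a < b /\ h (b + 2 * PI) = h b /\
    forall w, a <= w <= b -> h (w + 2 * PI) <= h w.
Proof.
intros Ch Hm Hp; assert (HP := PI_RGT_0).
set (f := fun w => h (w + 2 * PI) - h w).
assert (Cf : continuity f).
{ apply (continuity_minus (fun w => h (w + 2 * PI)) h); [ | exact Ch ].
  intros w; apply (continuity_pt_comp (fun w => w + 2 * PI) h); [ | apply Ch ].
  apply continuity_pt_plus;
    [ apply continuity_pt_id | apply continuity_pt_const; intros ? ?; reflexivity ]. }
assert (Pf : forall k w, f (w + INR k * (2 * INR m * PI)) = f w).
{ induction k as [ | k IH]; intros w.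
  - change (INR 0) with 0; f_equal; ring.
  - rewrite S_INR, <- (IH w); unfold f.
    replace (w + (INR k + 1) * (2 * INR m * PI))
      with (w + INR k * (2 * INR m * PI) + 2 * INR m * PI) by ring.
    replace (w + INR k * (2 * INR m * PI) + 2 * INR m * PI + 2 * PI)
      with (w + INR k * (2 * INR m * PI) + 2 * PI + 2 * INR m * PI) by ring.
    rewrite !Hp; reflexivity. }
destruct (classic (forall w, f w = 0)) as [Z | NZ].
{ exists (- (PI / 2)), 0; split; [ lra | split ].
  - specialize (Z 0); unfold f in Z; lra.
  - intros w _; specialize (Z w); unfold f in Z; lra. }
assert (Neg : exists a, f a < 0).
{ apply NNPP; intros Hn; apply NZ; intros w; unfold f.
  rewrite (periodic_monotone_shift h m Hm Hp); [ ring | ].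
  intros a; apply Rnot_lt_le; intros Hlt; apply Hn; exists a; unfold f; lra. }
assert (Pos : exists b, 0 < f b).
{ apply NNPP; intros Hn; apply NZ; intros w; unfold f.
  assert (K := periodic_monotone_shift (fun a => - h a) m Hm); cbv beta in K.
  enough (- h (w + 2 * PI) = - h w) by lra; apply K.
  - intros a; rewrite Hp; reflexivity.
  - intros a; apply Rnot_lt_le; intros Hlt; apply Hn; exists a; unfold f; lra. }
destruct Neg as [a Ha], Pos as [b0 Hb0].
assert (Hm' : 0 < 2 * INR m * PI) by (apply lt_INR in Hm; change (INR 0) with 0 in Hm; nra).
destruct (INR_unbounded (Rabs (a - b0) / (2 * INR m * PI))) as [k Hk].
apply Rmult_lt_compat_r with (1 := Hm') in Hk.
unfold Rdiv in Hk; rewrite Rmult_assoc, Rinv_l, Rmult_1_r in Hk by lra.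
assert (Hab := Rle_abs (a - b0)).
destruct (first_zero f a (b0 + INR k * (2 * INR m * PI)) Cf) as [b [Hb [Zb Nb]]].
- lra.
- exact Ha.
- rewrite Pf; lra.
- exists (Rmax a (b - PI / 2)), b; split; [ | split ].
  + split; [ apply Rmax_r | apply Rmax_lub_lt; lra ].
  + unfold f in Zb; lra.
  + intros w Hw; assert (Haw : a <= w) by (apply Rle_trans with (2 := proj1 Hw), Rmax_l).
    destruct (Rle_lt_or_eq_dec w b (proj2 Hw)) as [Hlt | ->]; [ | unfold f in Zb; lra ].
    specialize (Nb w ltac:(lra)); unfold f in Nb; lra.
Qed.

(** For smooth support functions the derivative of h(phi + 2 PI) - h(phi) at a
    zero is the signed distance [p] between the two points of contact, so [p] is
    nonnegative at an upcrossing.  With straight pieces only a one-sided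
    derivative is available: one takes for [s] the first parameter of its angle,
    so that the angles just before [s] are smaller, and estimates the difference
    quotient from the left. *)
Lemma common_tangent (c : R) (m : nat) (x y th : R -> R) :
  convex_loop c m x y th ->
  exists s t, th t = th s + 2 * PI /\
    (y t - y s) * cos (th s) = (x t - x s) * sin (th s) /\
    0 <= (x t - x s) * cos (th s) + (y t - y s) * sin (th s).
Proof.
intros L; assert (HP := PI_RGT_0).
destruct (support_function _ _ _ _ _ L) as [h [Ch [Ph [Hh Up]]]].
destruct (shift_upcrossing h m Ch (loop_turns _ _ _ _ _ L) Ph)
  as [a [b [Hab [Zb Nb]]]].
destruct (loop_arc _ _ _ _ _ L) as [Hc Dx Dy Ct Mt].
assert (H := loop_arc _ _ _ _ _ L).
destruct (loop_angle_onto _ _ _ _ _ L a) as [sa Hsa].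
destruct (loop_angle_onto _ _ _ _ _ L b) as [sb Hsb].
destruct (loop_angle_onto _ _ _ _ _ L (b + 2 * PI)) as [t Ht].
destruct (first_zero (fun w => th w - b) sa sb) as [s [Hs [Zs Ns]]].
{ apply (continuity_minus th (fun _ => b)); [ exact Ct | ].
  apply continuity_const; intros ? ?; reflexivity. }
{ left; apply (arc_lt _ _ _ _ _ _ H); lra. }
{ lra. }
{ lra. }
assert (Eb : th s = b) by lra; clear Zs.
exists s, t; rewrite Eb; split; [ lra | ].
assert (Et : support (x t) (y t) b = support (x s) (y s) b).
{ assert (E1 := Hh t); assert (E2 := Hh s); rewrite Ht in E1; rewrite Eb in E2.
  unfold support in *; replace (b + 2 * PI) with (b + 2 * INR 1 * PI) in E1
    by (change (INR 1) with 1; ring).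
  rewrite sin_period, cos_period in E1.
  rewrite <- E1, <- E2; change (INR 1) with 1.
  replace (b + 2 * 1 * PI) with (b + 2 * PI) by ring; exact Zb. }
split; [ unfold support in Et; lra | ].
set (p := (x t - x s) * cos b + (y t - y s) * sin b).
apply Rnot_lt_le; intros Hp.
(* The arc from [w] to [s] is to be shorter than [- p]. *)
set (w := Rmax sa (s - (- p) / (2 * c))).
assert (Hpc : 0 < (- p) / (2 * c)) by (apply Rdiv_lt_0_compat; lra).
assert (Hw : sa <= w < s /\ s - (- p) / (2 * c) <= w).
{ unfold w; generalize (Rmax_l sa (s - (- p) / (2 * c))),
    (Rmax_r sa (s - (- p) / (2 * c))); intros.
  repeat split; try lra; apply Rmax_lub_lt; lra. }
assert (Hlen : c * (s - w) <= - p / 2).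
{ apply Rle_trans with (c * (- p / (2 * c))); [ | right; field; lra ].
  apply Rmult_le_compat_l; lra. }
assert (Tw : th w < b) by (generalize (Ns w ltac:(lra)); lra).
assert (Ta : a <= th w) by (rewrite <- Hsa; apply Mt; lra).
assert (Sin : 0 < sin (b - th w)) by (apply sin_gt_0; lra).
assert (N := Nb (th w) ltac:(lra)).
rewrite (Hh w) in N.
assert (U := Up (th w + 2 * PI) t); rewrite Ht in U.
specialize (U ltac:(apply Rabs_le; lra)).
assert (E : support (x t) (y t) (th w + 2 * PI) = support (x t) (y t) (th w)).
{ unfold support; replace (th w + 2 * PI) with (th w + 2 * INR 1 * PI)
    by (change (INR 1) with 1; ring).
  rewrite sin_period, cos_period; reflexivity. }
rewrite E in U; clear E.
assert (G := derive_lower_bound _ _ w s (- (c * sin (b - th w)))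
  (fun u => is_derive_support c x y th (th w) u H) ltac:(lra)); cbv beta in G.
assert (G' : - (c * sin (b - th w)) * (s - w) <=
             support (x s) (y s) (th w) - support (x w) (y w) (th w)).
{ apply G; intros u Hu.
  assert (th w <= th u) by (apply Mt; lra).
  assert (th u <= b) by (rewrite <- Eb; apply Mt; lra).
  assert (sin (th u - th w) <= sin (b - th w)) by (apply sin_incr_1; lra).
  replace (th w - th u) with (- (th u - th w)) by ring; rewrite sin_neg; nra. }
assert (E : support (x t) (y t) (th w) - support (x s) (y s) (th w)
            = - p * sin (b - th w)).
{ assert (S1 := sin2_cos2 b); unfold Rsqr in S1.
  unfold support in Et.
  assert (EX : x t - x s = p * cos b).
  { unfold p; transitivity ((x t - x s) * (sin b * sin b + cos b * cos b));
      [ rewrite S1; ring | ].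
    replace ((x t - x s) * (sin b * sin b + cos b * cos b))
      with (((x t * sin b) - x s * sin b) * sin b + (x t - x s) * cos b * cos b) by ring.
    replace (x t * sin b - x s * sin b) with ((y t - y s) * cos b) by lra; ring. }
  assert (EY : y t - y s = p * sin b).
  { unfold p; transitivity ((y t - y s) * (sin b * sin b + cos b * cos b));
      [ rewrite S1; ring | ].
    replace ((y t - y s) * (sin b * sin b + cos b * cos b))
      with (((y t * cos b) - y s * cos b) * cos b + (y t - y s) * sin b * sin b) by ring.
    replace (y t * cos b - y s * cos b) with ((x t - x s) * sin b) by lra; ring. }
  unfold support; rewrite sin_minus.
  replace (x t) with (x s + p * cos b) by lra.
  replace (y t) with (y s + p * sin b) by lra; ring. }
nra.
Qed.

(** As [m > 1], one full turn takes less than a period, so that the two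
    parameters of the crossing differ modulo 2 PI. *)
Lemma many_turns_crossing (c : R) (m : nat) (x y th : R -> R) :
  convex_loop c m x y th -> (1 < m)%nat ->
  exists u v, u < v < u + 2 * PI /\ x u = x v /\ y u = y v.
Proof.
intros L Hm; assert (HP := PI_RGT_0).
destruct (common_tangent _ _ _ _ _ L) as [s [t [Ht [Et Pt]]]].
assert (H := loop_arc _ _ _ _ _ L).
assert (Hst : t < s + 2 * PI).
{ apply (arc_lt _ _ _ _ _ _ H); rewrite (loop_th _ _ _ _ _ L), Ht.
  apply lt_INR in Hm; change (INR 1) with 1 in Hm; nra. }
destruct (full_turn_crossing _ _ _ _ s t (convex_arc_rotate _ _ _ _ (th s) H))
  as [u [v [Hu [Huv [Hv [Ex Ey]]]]]]; try lra.
exists u, v; split; [ lra | ].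
assert (S1 := sin2_cos2 (th s)); unfold Rsqr in S1.
set (X := fun w => cos (th s) * x w + sin (th s) * y w) in *.
set (Y := fun w => cos (th s) * y w - sin (th s) * x w) in *.
assert (RX : forall w, x w = cos (th s) * X w - sin (th s) * Y w).
{ intros w; unfold X, Y.
  transitivity (x w * (sin (th s) * sin (th s) + cos (th s) * cos (th s)));
    [ rewrite S1 | ]; ring. }
assert (RY : forall w, y w = sin (th s) * X w + cos (th s) * Y w).
{ intros w; unfold X, Y.
  transitivity (y w * (sin (th s) * sin (th s) + cos (th s) * cos (th s)));
    [ rewrite S1 | ]; ring. }
change (X u = X v) in Ex; change (Y u = Y v) in Ey.
rewrite (RX u), (RX v), (RY u), (RY v), Ex, Ey; auto.
Qed.

Lemma polar_angle (c p q : R) :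
  0 < c -> p * p + q * q = c * c -> exists phi, p = c * cos phi /\ q = c * sin phi.
Proof.
intros Hc E.
set (a := p / c).
assert (Ea : p = c * a) by (unfold a; field; lra).
set (b := q / c).
assert (Eb : q = c * b) by (unfold b; field; lra).
assert (Eab : a * a + b * b = 1).
{ rewrite Ea, Eb in E; apply Rmult_eq_reg_l with (c * c); nra. }
assert (Ha : -1 <= a <= 1) by (split; nra).
assert (Hs : sin (acos a) = Rabs b).
{ rewrite sin_acos by exact Ha; rewrite <- sqrt_Rsqr_abs; f_equal; unfold Rsqr; lra. }
destruct (Rle_dec 0 b) as [Hb | Hb].
- exists (acos a); rewrite Hs, (cos_acos a Ha), Rabs_right by lra; auto.
- exists (- acos a); rewrite sin_neg, cos_neg, Hs, (cos_acos a Ha), Rabs_left by lra.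
  split; [ exact Ea | lra ].
Qed.

Lemma same_angle (a b : R) :
  cos a = cos b -> sin a = sin b -> exists k : Z, a = b + 2 * IZR k * PI.
Proof.
intros Ec Es.
assert (H : cos (a - b) = 1).
{ rewrite cos_minus, Ec, Es; generalize (sin2_cos2 b); unfold Rsqr; lra. }
replace (a - b) with (2 * ((a - b) / 2)) in H by field.
rewrite cos_2a_sin in H.
assert (Z : sin ((a - b) / 2) = 0) by nra.
destruct (sin_eq_0_0 _ Z) as [k Hk]; exists k; lra.
Qed.

(** The angle is the primitive of its known derivative.  That it is the angle of
    the velocity is uniqueness for the linear system satisfied by the velocity. *)
Lemma continuous_angle (c : R) (x1 y1 x2 y2 : R -> R) :
  0 < c ->
  (forall t, is_derive x1 t (x2 t)) -> (forall t, is_derive y1 t (y2 t)) ->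
  continuity x2 -> continuity y2 ->
  (forall t, x1 t * x1 t + y1 t * y1 t = c * c) ->
  exists th,
    (forall t, is_derive th t ((x1 t * y2 t - y1 t * x2 t) / (c * c))) /\
    (forall t, x1 t = c * cos (th t)) /\ (forall t, y1 t = c * sin (th t)).
Proof.
intros Hc Dx Dy Cx2 Cy2 E.
assert (Cx := derivable_continuity _ _ Dx).
assert (Cy := derivable_continuity _ _ Dy).
set (k := fun t => (x1 t * y2 t - y1 t * x2 t) / (c * c)).
assert (Ck : continuity k).
{ apply (continuity_mult (fun t => x1 t * y2 t - y1 t * x2 t) (fun _ => / (c * c))).
  - apply (continuity_minus (fun t => x1 t * y2 t) (fun t => y1 t * x2 t)).
    + apply continuity_mult; assumption.
    + apply continuity_mult; assumption.
  - apply continuity_const; intros ? ?; reflexivity. }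
destruct (continuous_primitive k 0 Ck) as [g [G0 Dg]].
destruct (polar_angle c (x1 0) (y1 0) Hc (E 0)) as [phi [Hx0 Hy0]].
set (th := fun t => phi + g t).
assert (Dth : forall t, is_derive th t (k t)).
{ intros t; apply (is_derive_val _ _ (0 + k t)); [ | ring ].
  apply is_derive_Rplus; [ apply is_derive_Rconst | apply Dg ]. }
assert (Dc : forall t, is_derive (fun u => cos (th u)) t (k t * - sin (th t))).
{ intros t; apply (is_derive_comp cos th); [ apply is_derive_cos | apply Dth ]. }
assert (Ds : forall t, is_derive (fun u => sin (th u)) t (k t * cos (th t))).
{ intros t; apply (is_derive_comp sin th); [ apply is_derive_sin | apply Dth ]. }
assert (Orth : forall t, x1 t * x2 t + y1 t * y2 t = 0).
{ intros t.
  enough (x2 t * x1 t + x1 t * x2 t + (y2 t * y1 t + y1 t * y2 t) = 0) by lra.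
  apply (is_derive_inj (fun u => x1 u * x1 u + y1 u * y1 u) t).
  - apply is_derive_Rplus; apply is_derive_Rmult; auto.
  - apply (is_derive_Rext (fun _ => c * c)); [ intros u; rewrite E; reflexivity | ].
    apply is_derive_Rconst. }
assert (Hcc : c * c <> 0) by nra.
assert (EX : forall t, x2 t = - k t * y1 t).
{ intros t; apply Rmult_eq_reg_l with (c * c); [ | exact Hcc ].
  unfold k; replace (c * c * (- ((x1 t * y2 t - y1 t * x2 t) / (c * c)) * y1 t))
    with (- (x1 t * y2 t - y1 t * x2 t) * y1 t) by (field; lra).
  rewrite <- (E t); generalize (Orth t); intros O.
  replace (- (x1 t * y2 t - y1 t * x2 t) * y1 t)
    with (- x1 t * (y1 t * y2 t) + y1 t * y1 t * x2 t) by ring.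
  replace (y1 t * y2 t) with (- (x1 t * x2 t)) by lra; ring. }
assert (EY : forall t, y2 t = k t * x1 t).
{ intros t; apply Rmult_eq_reg_l with (c * c); [ | exact Hcc ].
  unfold k; replace (c * c * ((x1 t * y2 t - y1 t * x2 t) / (c * c) * x1 t))
    with ((x1 t * y2 t - y1 t * x2 t) * x1 t) by (field; lra).
  rewrite <- (E t); generalize (Orth t); intros O.
  replace ((x1 t * y2 t - y1 t * x2 t) * x1 t)
    with (x1 t * x1 t * y2 t - y1 t * (x1 t * x2 t)) by ring.
  replace (x1 t * x2 t) with (- (y1 t * y2 t)) by lra; ring. }
(* In the frame turning by [th] the velocity is the constant vector (c, 0). *)
assert (K1 : forall t, x1 t * cos (th t) + y1 t * sin (th t) = c).
{ intros t.
  rewrite (derive_zero_const (fun u => x1 u * cos (th u) + y1 u * sin (th u))) with (t := 0).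
  - unfold th; rewrite G0, Rplus_0_r, Hx0, Hy0.
    generalize (sin2_cos2 phi); unfold Rsqr; intros S; nra.
  - intros u; eapply is_derive_val;
      [ apply is_derive_Rplus; apply is_derive_Rmult; auto | ].
    cbv beta; rewrite EX, EY; ring. }
assert (K2 : forall t, y1 t * cos (th t) - x1 t * sin (th t) = 0).
{ intros t.
  rewrite (derive_zero_const (fun u => y1 u * cos (th u) - x1 u * sin (th u))) with (t := 0).
  - unfold th; rewrite G0, Rplus_0_r, Hx0, Hy0; ring.
  - intros u; eapply is_derive_val;
      [ apply is_derive_Rminus; apply is_derive_Rmult; auto | ].
    cbv beta; rewrite EX, EY; ring. }
exists th; split; [ exact Dth | ].
split; intros t; generalize (sin2_cos2 (th t)) (K1 t) (K2 t); unfold Rsqr; intros S A B.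
- transitivity (x1 t * (sin (th t) * sin (th t) + cos (th t) * cos (th t)));
    [ rewrite S; ring | ].
  rewrite <- A.
  transitivity ((x1 t * cos (th t) + y1 t * sin (th t)) * cos (th t)
    - (y1 t * cos (th t) - x1 t * sin (th t)) * sin (th t)); [ ring | rewrite B; ring ].
- transitivity (y1 t * (sin (th t) * sin (th t) + cos (th t) * cos (th t)));
    [ rewrite S; ring | ].
  rewrite <- A.
  transitivity ((x1 t * cos (th t) + y1 t * sin (th t)) * sin (th t)
    + (y1 t * cos (th t) - x1 t * sin (th t)) * cos (th t)); [ ring | rewrite B; ring ].
Qed.

(** The function [a] is twice the signed area swept by the segment from the point
    of parameter [t0]. *)
Lemma zero_area_crossing (c t0 : R) (x y x1 y1 x2 y2 a : R -> R) :
  0 < c ->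
  (forall t, is_derive x t (x1 t)) -> (forall t, is_derive y t (y1 t)) ->
  (forall t, is_derive x1 t (x2 t)) -> (forall t, is_derive y1 t (y2 t)) ->
  continuity x2 -> continuity y2 ->
  (forall t, x (t + 2 * PI) = x t) -> (forall t, y (t + 2 * PI) = y t) ->
  (forall t, x1 t * x1 t + y1 t * y1 t = c * c) ->
  (forall t, 0 <= x1 t * y2 t - y1 t * x2 t) ->
  (forall t, is_derive a t ((x t - x t0) * y1 t - (y t - y t0) * x1 t)) ->
  a t0 = a (t0 + 2 * PI) ->
  exists u v, u < v < u + 2 * PI /\ x u = x v /\ y u = y v.
Proof.
intros Hc Dx Dy Dx1 Dy1 Cx2 Cy2 Px Py E K Da Ea.
assert (HP := PI_RGT_0).
destruct (continuous_angle c x1 y1 x2 y2 Hc Dx1 Dy1 Cx2 Cy2 E) as [th [Dth [Ex Ey]]].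
assert (Px1 := periodic_derive _ _ _ Dx Px).
assert (Py1 := periodic_derive _ _ _ Dy Py).
assert (Px2 := periodic_derive _ _ _ Dx1 Px1).
assert (Py2 := periodic_derive _ _ _ Dy1 Py1).
assert (Mt : forall s t, s <= t -> th s <= th t).
{ intros s t Hst; assert (G := derive_lower_bound th _ s t 0 Dth Hst); cbv beta in G.
  rewrite Rmult_0_l in G; enough (0 <= th t - th s) by lra; apply G; intros w _.
  apply Rdiv_le_0_compat; [ apply K | nra ]. }
assert (Arc : convex_arc c x y th).
{ split; auto.
  - intros t; rewrite <- Ex; auto.
  - intros t; rewrite <- Ey; auto.
  - apply (derivable_continuity _ _ Dth). }
assert (Turn : exists m : nat, forall t, th (t + 2 * PI) = th t + 2 * INR m * PI).
{ destruct (same_angle (th (0 + 2 * PI)) (th 0)) as [k Hk].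
  - apply Rmult_eq_reg_l with c; [ | lra ]; rewrite <- !Ex; apply Px1.
  - apply Rmult_eq_reg_l with c; [ | lra ]; rewrite <- !Ey; apply Py1.
  - assert (Hk0 : (0 <= k)%Z).
    { apply le_IZR; generalize (Mt 0 (0 + 2 * PI) ltac:(lra)); nra. }
    exists (Z.to_nat k); intros t.
    rewrite INR_IZR_INZ, Z2Nat.id by exact Hk0.
    enough (th (t + 2 * PI) - th t = th (0 + 2 * PI) - th 0) by lra.
    apply (derive_zero_const (fun u => th (u + 2 * PI) - th u)).
    intros u; eapply is_derive_val;
      [ apply is_derive_Rminus; [ apply is_derive_shift, Dth | apply Dth ] | ].
    cbv beta; rewrite Px1, Py1, Px2, Py2; ring. }
destruct Turn as [m Ht].
destruct m as [ | m].
-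
  (* A curve that does not turn is a straight line, which does not close up. *)
  exfalso.
  change (INR 0) with 0 in Ht.
  assert (T0 : forall t, 0 <= t <= 0 + 2 * PI -> th t = th 0).
  { intros t Ht'; generalize (Mt 0 t ltac:(lra)), (Mt t (0 + 2 * PI) ltac:(lra)).
    rewrite (Ht 0); lra. }
  destruct (mean_value x x1 0 (0 + 2 * PI) Dx ltac:(lra)) as [w [Hw Fx]].
  destruct (mean_value y y1 0 (0 + 2 * PI) Dy ltac:(lra)) as [w' [Hw' Fy]].
  rewrite Px, Ex, (T0 w Hw) in Fx; rewrite Py, Ey, (T0 w' Hw') in Fy.
  assert (Zc : cos (th 0) = 0) by (apply Rmult_eq_reg_l with (c * (2 * PI)); nra).
  assert (Zs : sin (th 0) = 0) by (apply Rmult_eq_reg_l with (c * (2 * PI)); nra).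
  generalize (sin2_cos2 (th 0)); rewrite Zc, Zs; unfold Rsqr; lra.
- assert (L : convex_loop c (S m) x y th) by (split; auto; lia).
  destruct m as [ | m]; [ | apply (many_turns_crossing _ _ _ _ _ L); lia ].
  exfalso; apply (one_turn_area_pos c x y th a t0 L); [ | exact Ea ].
  intros t; rewrite <- Ex, <- Ey; apply Da.
Qed.

(** * Uniform convergence *)

(** Uniform convergence on the ball of radius [r] about [t0], the point where
    primitives are normalized.  A bound on the limit is part of the notion so that
    it is stable under products.  For [r = 0] this is convergence at [t0]. *)
Definition uconv (t0 r : R) (u : nat -> R -> R) (l : R -> R) : Prop :=
  (exists M, 0 < M /\ forall t, Rabs (t - t0) <= r -> Rabs (l t) <= M) /\
  forall eps, 0 < eps -> exists N, forall n, (N <= n)%nat ->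
    forall t, Rabs (t - t0) <= r -> Rabs (u n t - l t) < eps.

Lemma uconv_ext (t0 r : R) (u u' : nat -> R -> R) (l l' : R -> R) :
  (forall n t, u n t = u' n t) -> (forall t, l t = l' t) ->
  uconv t0 r u l -> uconv t0 r u' l'.
Proof.
intros Eu El [[M [HM B]] H]; split.
- exists M; split; [ exact HM | ]; intros t Ht; rewrite <- El; auto.
- intros eps He; destruct (H eps He) as [N HN]; exists N; intros n Hn t Ht.
  rewrite <- El, <- Eu; auto.
Qed.

Lemma uconv_const (t0 r : R) (u : nat -> R) (l : R) :
  Un_cv u l -> uconv t0 r (fun n _ => u n) (fun _ => l).
Proof.
intros H; split.
- exists (Rabs l + 1); generalize (Rabs_pos l); intros; split; [ lra | intros; lra ].
- intros eps He; destruct (H eps He) as [N HN]; exists N; intros n Hn t _; apply HN, Hn.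
Qed.

Lemma uconv_plus (t0 r : R) (u v : nat -> R -> R) (l m : R -> R) :
  uconv t0 r u l -> uconv t0 r v m ->
  uconv t0 r (fun n t => u n t + v n t) (fun t => l t + m t).
Proof.
intros [[M1 [P1 B1]] H1] [[M2 [P2 B2]] H2]; split.
- exists (M1 + M2); split; [ lra | ]; intros t Ht.
  apply Rle_trans with (1 := Rabs_triang _ _); apply Rplus_le_compat; auto.
- intros eps He.
  destruct (H1 (eps / 2) ltac:(lra)) as [N1 K1].
  destruct (H2 (eps / 2) ltac:(lra)) as [N2 K2].
  exists (Nat.max N1 N2); intros n Hn t Ht.
  specialize (K1 n ltac:(lia) t Ht); specialize (K2 n ltac:(lia) t Ht).
  replace (u n t + v n t - (l t + m t)) with ((u n t - l t) + (v n t - m t)) by ring.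
  apply Rle_lt_trans with (1 := Rabs_triang _ _); lra.
Qed.

Lemma uconv_mult (t0 r : R) (u v : nat -> R -> R) (l m : R -> R) :
  uconv t0 r u l -> uconv t0 r v m ->
  uconv t0 r (fun n t => u n t * v n t) (fun t => l t * m t).
Proof.
intros [[M1 [P1 B1]] H1] [[M2 [P2 B2]] H2]; split.
- exists (M1 * M2); split; [ nra | ]; intros t Ht; rewrite Rabs_mult.
  apply Rmult_le_compat; auto using Rabs_pos.
- intros eps He.
  set (e := Rmin 1 (eps / (2 * (M1 + M2 + 1)))).
  assert (Hq : 0 < eps / (2 * (M1 + M2 + 1))) by (apply Rdiv_lt_0_compat; lra).
  assert (He0 : 0 < e) by (apply Rmin_pos; lra).
  assert (He1 : e <= 1) by apply Rmin_l.
  assert (He2 : (M1 + M2 + 1) * e <= eps / 2).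
  { apply Rle_trans with ((M1 + M2 + 1) * (eps / (2 * (M1 + M2 + 1)))).
    - apply Rmult_le_compat_l; [ lra | apply Rmin_r ].
    - right; field; lra. }
  destruct (H1 e He0) as [N1 K1]; destruct (H2 e He0) as [N2 K2].
  exists (Nat.max N1 N2); intros n Hn t Ht.
  specialize (K1 n ltac:(lia) t Ht); specialize (K2 n ltac:(lia) t Ht).
  specialize (B1 t Ht); specialize (B2 t Ht).
  replace (u n t * v n t - l t * m t)
    with ((u n t - l t) * (v n t - m t) + ((u n t - l t) * m t + l t * (v n t - m t)))
    by ring.
  apply Rle_lt_trans with (1 := Rabs_triang _ _).
  apply Rle_lt_trans with (e * 1 + (e * M2 + M1 * e)); [ | nra ].
  apply Rplus_le_compat.
  + rewrite Rabs_mult; apply Rmult_le_compat; auto using Rabs_pos; lra.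
  + apply Rle_trans with (1 := Rabs_triang _ _); rewrite !Rabs_mult.
    apply Rplus_le_compat; apply Rmult_le_compat; auto using Rabs_pos; lra.
Qed.

Lemma uconv_minus (t0 r : R) (u v : nat -> R -> R) (l m : R -> R) :
  uconv t0 r u l -> uconv t0 r v m ->
  uconv t0 r (fun n t => u n t - v n t) (fun t => l t - m t).
Proof.
intros Hu Hv.
apply (uconv_ext t0 r (fun n t => u n t + (-1) * v n t) _ (fun t => l t + (-1) * m t));
  [ intros; ring | intros; ring | ].
apply uconv_plus; [ exact Hu | ]; apply uconv_mult; [ | exact Hv ].
apply (uconv_const t0 r (fun _ => -1)); intros eps He; exists 0%nat; intros n _.
unfold Rdist; rewrite Rminus_diag, Rabs_R0; exact He.
Qed.

Lemma uconv_zero_bounded (t0 r M : R) (z w : nat -> R -> R) :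
  uconv t0 r z (fun _ => 0) -> (forall n t, Rabs (w n t) <= M) ->
  uconv t0 r (fun n t => z n t * w n t) (fun _ => 0).
Proof.
intros [B H] Hw; split; [ exact B | ].
assert (HM : 0 <= M) by (apply Rle_trans with (2 := Hw 0%nat 0), Rabs_pos).
intros eps He; destruct (H (eps / (M + 1))) as [N HN].
{ apply Rdiv_lt_0_compat; lra. }
exists N; intros n Hn t Ht; specialize (HN n Hn t Ht).
rewrite Rminus_0_r in *; rewrite Rabs_mult.
apply Rle_lt_trans with (Rabs (z n t) * M).
- apply Rmult_le_compat_l; [ apply Rabs_pos | apply Hw ].
- apply Rlt_le_trans with (eps / (M + 1) * (M + 1)); [ | right; field; lra ].
  generalize (Rabs_pos (z n t)); intros; nra.
Qed.

Lemma uconv_point (t0 r : R) (u : nat -> R -> R) (l : R -> R) (t : R) :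
  uconv t0 r u l -> Rabs (t - t0) <= r -> Un_cv (fun n => u n t) (l t).
Proof.
intros [_ H] Ht eps He; destruct (H eps He) as [N HN]; exists N; intros n Hn.
apply HN; assumption.
Qed.

Lemma derive_bound (f f' : R -> R) (t0 r M : R) :
  (forall t, is_derive f t (f' t)) ->
  (forall t, Rabs (t - t0) <= r -> Rabs (f' t) <= M) ->
  forall t, Rabs (t - t0) <= r -> Rabs (f t - f t0) <= M * r.
Proof.
intros Hf HM t Ht.
assert (Hr : 0 <= r) by (apply Rle_trans with (2 := Ht), Rabs_pos).
assert (K : exists w, Rabs (w - t0) <= r /\ f t - f t0 = f' w * (t - t0)).
{ apply Rabs_le_between in Ht; destruct (Rle_dec t0 t) as [H | H].
  - destruct (mean_value f f' t0 t Hf H) as [w [Hw E]]; exists w.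
    split; [ apply Rabs_le; lra | exact E ].
  - destruct (mean_value f f' t t0 Hf ltac:(lra)) as [w [Hw E]]; exists w.
    split; [ apply Rabs_le; lra | lra ]. }
destruct K as [w [Hw ->]]; rewrite Rabs_mult.
apply Rmult_le_compat; auto using Rabs_pos.
Qed.

Lemma uconv_primitive (t0 r : R) (u v : nat -> R -> R) (l m : R -> R) :
  0 <= r ->
  (forall n t, is_derive (u n) t (v n t)) -> (forall t, is_derive l t (m t)) ->
  uconv t0 r v m -> Un_cv (fun n => u n t0) (l t0) -> uconv t0 r u l.
Proof.
intros Hr Du Dl [[M [HM B]] H] H0; split.
- exists (Rabs (l t0) + M * r + 1); split; [ generalize (Rabs_pos (l t0)); nra | ].
  intros t Ht; assert (K := derive_bound l m t0 r M Dl B t Ht).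
  replace (l t) with (l t0 + (l t - l t0)) by ring.
  apply Rle_trans with (1 := Rabs_triang _ _); lra.
- intros eps He.
  destruct (H (eps / (2 * (r + 1)))) as [N1 K1]; [ apply Rdiv_lt_0_compat; lra | ].
  destruct (H0 (eps / 2) ltac:(lra)) as [N2 K2].
  exists (Nat.max N1 N2); intros n Hn t Ht.
  specialize (K2 n ltac:(lia)); unfold Rdist in K2.
  assert (K := derive_bound (fun s => u n s - l s) (fun s => v n s - m s) t0 r
    (eps / (2 * (r + 1)))); cbv beta in K.
  assert (K' : Rabs (u n t - l t - (u n t0 - l t0)) <= eps / (2 * (r + 1)) * r).
  { apply K; [ | | exact Ht ].
    - intros s; apply is_derive_Rminus; auto.
    - intros s Hs; left; apply K1; [ lia | exact Hs ]. }
  assert (Hs : eps / (2 * (r + 1)) * r < eps / 2).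
  { apply Rmult_lt_reg_r with (2 * (r + 1)); [ lra | ].
    replace (eps / (2 * (r + 1)) * r * (2 * (r + 1))) with (eps * r) by (field; lra).
    lra. }
  replace (u n t - l t) with ((u n t0 - l t0) + (u n t - l t - (u n t0 - l t0))) by ring.
  apply Rle_lt_trans with (1 := Rabs_triang _ _); lra.
Qed.

(** * Vector calculus *)

Ltac vec := unfold sub3, scal3, cross, dot, c1, c2, c3 in *; cbn [fst snd] in *.

Definition derive3 (F : R -> R3) (t : R) (v : R3) : Prop :=
  is_derive (fun u => c1 (F u)) t (c1 v) /\
  is_derive (fun u => c2 (F u)) t (c2 v) /\
  is_derive (fun u => c3 (F u)) t (c3 v).

Definition uconv3 (t0 r : R) (u : nat -> R -> R3) (l : R -> R3) : Prop :=
  uconv t0 r (fun n t => c1 (u n t)) (fun t => c1 (l t)) /\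
  uconv t0 r (fun n t => c2 (u n t)) (fun t => c2 (l t)) /\
  uconv t0 r (fun n t => c3 (u n t)) (fun t => c3 (l t)).

Lemma uconv3_cross (t0 r : R) (u v : nat -> R -> R3) (l m : R -> R3) :
  uconv3 t0 r u l -> uconv3 t0 r v m ->
  uconv3 t0 r (fun n t => cross (u n t) (v n t)) (fun t => cross (l t) (m t)).
Proof.
intros [U1 [U2 U3]] [V1 [V2 V3]]; unfold uconv3; vec.
split; [ | split ]; apply uconv_minus; apply uconv_mult; assumption.
Qed.

Lemma uconv3_dot (t0 r : R) (u v : nat -> R -> R3) (l m : R -> R3) :
  uconv3 t0 r u l -> uconv3 t0 r v m ->
  uconv t0 r (fun n t => dot (u n t) (v n t)) (fun t => dot (l t) (m t)).
Proof.
intros [U1 [U2 U3]] [V1 [V2 V3]]; vec.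
apply uconv_plus; [ apply uconv_plus | ]; apply uconv_mult; assumption.
Qed.

Lemma uconv3_const (t0 r : R) (b : R3) : uconv3 t0 r (fun _ _ => b) (fun _ => b).
Proof.
split; [ | split ]; apply (uconv_const t0 r (fun _ => _)); intros eps He; exists 0%nat;
  intros n _; unfold Rdist; rewrite Rminus_diag, Rabs_R0; exact He.
Qed.

Lemma derive3_dot (F G : R -> R3) (t : R) (v w : R3) :
  derive3 F t v -> derive3 G t w ->
  is_derive (fun u => dot (F u) (G u)) t (dot v (G t) + dot (F t) w).
Proof.
intros [F1 [F2 F3]] [G1 [G2 G3]].
eapply is_derive_val.
- unfold dot; apply is_derive_Rplus; [ apply is_derive_Rplus | ];
    apply is_derive_Rmult; eassumption.
- unfold dot; ring.
Qed.

Lemma derive3_cross (F G : R -> R3) (t : R) (v w : R3) :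
  derive3 F t v -> derive3 G t w ->
  derive3 (fun u => cross (F u) (G u)) t
    (c1 (cross v (G t)) + c1 (cross (F t) w),
     c2 (cross v (G t)) + c2 (cross (F t) w),
     c3 (cross v (G t)) + c3 (cross (F t) w)).
Proof.
intros [F1 [F2 F3]] [G1 [G2 G3]]; unfold derive3; vec.
split; [ | split ]; (eapply is_derive_val;
  [ apply is_derive_Rminus; apply is_derive_Rmult; eassumption | cbv beta; ring ]).
Qed.

Lemma dot_pos (p : R3) : 0 <= dot p p.
Proof. vec; nra. Qed.

Lemma norm3_sqr (p : R3) : norm3 p * norm3 p = dot p p.
Proof. apply sqrt_sqrt, dot_pos. Qed.

Lemma coord_le_norm3 (p : R3) :
  Rabs (c1 p) <= norm3 p /\ Rabs (c2 p) <= norm3 p /\ Rabs (c3 p) <= norm3 p.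
Proof.
split; [ | split ]; rewrite <- sqrt_Rsqr_abs; apply sqrt_le_1_alt; unfold dot;
  generalize (Rle_0_sqr (c1 p)), (Rle_0_sqr (c2 p)), (Rle_0_sqr (c3 p)); unfold Rsqr; lra.
Qed.

(** * The binormal of a curve of constant torsion *)

Definition binormal (V A : R -> R3) (t : R) : R3 :=
  scal3 (/ norm3 (cross (V t) (A t))) (cross (V t) (A t)).

(** With W = V x A and W' = V x J the equation amounts to the identity
    |W|^2 W' - (W . W') W = (W . J) V x W, which holds for arbitrary vectors
    V, A, J. *)
Lemma binormal_equation (V A J : R -> R3) (tau : R) :
  (forall t, derive3 V t (A t)) -> (forall t, derive3 A t (J t)) ->
  (forall t, 0 < dot (cross (V t) (A t)) (cross (V t) (A t))) ->
  (forall t, dot (cross (V t) (A t)) (J t) / norm3 (cross (V t) (A t)) ^ 2 = tau) ->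
  forall t, derive3 (binormal V A) t (scal3 tau (cross (V t) (binormal V A t))).
Proof.
intros DV DA Hpos Htau t.
assert (DW : derive3 (fun u => cross (V u) (A u)) t (cross (V t) (J t))).
{ destruct (derive3_cross _ _ _ _ _ (DV t) (DA t)) as [D1 [D2 D3]].
  split; [ | split ]; eapply is_derive_val; try eassumption; vec; ring. }
assert (Dq := derive3_dot _ _ _ _ _ DW DW).
assert (Hw : 0 < norm3 (cross (V t) (A t))) by (apply sqrt_lt_R0, Hpos).
assert (Dn := is_derive_sqrt _ _ _ Dq (Hpos t)).
assert (Di := is_derive_inv _ _ _ Dn ltac:(apply Rgt_not_eq, Hw)); clear Dn.
assert (Sq := norm3_sqr (cross (V t) (A t))).
specialize (Htau t).
destruct DW as [D1 [D2 D3]].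
unfold binormal.
change (fun x => / sqrt (dot (cross (V x) (A x)) (cross (V x) (A x))))
  with (fun x => / norm3 (cross (V x) (A x))) in Di.
change (sqrt (dot (cross (V t) (A t)) (cross (V t) (A t))))
  with (norm3 (cross (V t) (A t))) in Di.
set (w := norm3 (cross (V t) (A t))) in *.
assert (Key : forall x x' z,
  dot (cross (V t) (A t)) (cross (V t) (A t)) * x'
    - x * dot (cross (V t) (A t)) (cross (V t) (J t))
    = dot (cross (V t) (A t)) (J t) * z ->
  - ((dot (cross (V t) (J t)) (cross (V t) (A t)) +
      dot (cross (V t) (A t)) (cross (V t) (J t))) / (2 * w)) / w ^ 2 * x + / w * x'
  = tau * (/ w * z)).
{ intros x x' z Hz; rewrite <- Htau.
  apply Rmult_eq_reg_l with (w * w * w);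
    [ | apply Rgt_not_eq; repeat apply Rmult_lt_0_compat; exact Hw ].
  transitivity (dot (cross (V t) (A t)) (J t) * z); [ | field; lra ].
  rewrite <- Hz, <- Sq.
  replace (dot (cross (V t) (J t)) (cross (V t) (A t)))
    with (dot (cross (V t) (A t)) (cross (V t) (J t))) by (unfold dot; ring).
  field; lra. }
split; [ | split ]; cbn [c1 c2 c3 scal3 fst snd].
- eapply is_derive_val; [ exact (is_derive_Rmult _ _ _ _ _ Di D1) | ].
  transitivity (tau * (/ w * c1 (cross (V t) (cross (V t) (A t)))));
    [ apply Key; clear; vec; ring | clear; vec; ring ].
- eapply is_derive_val; [ exact (is_derive_Rmult _ _ _ _ _ Di D2) | ].
  transitivity (tau * (/ w * c2 (cross (V t) (cross (V t) (A t)))));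
    [ apply Key; clear; vec; ring | clear; vec; ring ].
- eapply is_derive_val; [ exact (is_derive_Rmult _ _ _ _ _ Di D3) | ].
  transitivity (tau * (/ w * c3 (cross (V t) (cross (V t) (A t)))));
    [ apply Key; clear; vec; ring | clear; vec; ring ].
Qed.

Lemma dot_zero (p : R3) : dot p p = 0 -> p = (0, 0, 0).
Proof.
destruct p as [[p1 p2] p3]; vec; intros H.
generalize (Rle_0_sqr p1), (Rle_0_sqr p2), (Rle_0_sqr p3); unfold Rsqr; intros.
repeat f_equal; apply Rsqr_0_uniq; unfold Rsqr; lra.
Qed.

Lemma binormal_frame (V A : R -> R3) (t : R) :
  0 < dot (cross (V t) (A t)) (cross (V t) (A t)) ->
  dot (binormal V A t) (binormal V A t) = 1 /\
  dot (binormal V A t) (V t) = 0 /\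
  0 <= dot (binormal V A t) (cross (V t) (A t)).
Proof.
intros H.
assert (Hw : 0 < norm3 (cross (V t) (A t))) by (apply sqrt_lt_R0, H).
assert (Sq := norm3_sqr (cross (V t) (A t))).
unfold binormal; set (w := norm3 (cross (V t) (A t))) in *.
assert (E1 : forall p q, dot (scal3 (/ w) p) q = / w * dot p q)
  by (intros; clear; vec; ring).
assert (E2 : forall p q, dot p (scal3 (/ w) q) = / w * dot p q)
  by (intros; clear; vec; ring).
rewrite E1, E2, !E1, <- Sq; split; [ field; lra | split ].
- replace (dot (cross (V t) (A t)) (V t)) with 0 by (clear; vec; ring); ring.
- apply Rmult_le_pos; [ left; apply Rinv_0_lt_compat, Hw | nra ].
Qed.

(** The derivatives of the binormals converge to zero, because [tau] does and
    the other factors are bounded. *)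
Lemma binormal_uconv (t0 r : R) (V_ B_ : nat -> R -> R3) (V : R -> R3)
    (tau : nat -> R) (b : R3) :
  0 <= r -> uconv3 t0 r V_ V -> Un_cv tau 0 ->
  (forall n t, derive3 (B_ n) t (scal3 (tau n) (cross (V_ n t) (B_ n t)))) ->
  (forall n t, dot (B_ n t) (B_ n t) = 1) ->
  Un_cv (fun n => c1 (B_ n t0)) (c1 b) -> Un_cv (fun n => c2 (B_ n t0)) (c2 b) ->
  Un_cv (fun n => c3 (B_ n t0)) (c3 b) ->
  uconv3 t0 r B_ (fun _ => b).
Proof.
intros Hr [U1 [U2 U3]] Ht DB BB L1 L2 L3.
assert (Bd : forall n t, Rabs (c1 (B_ n t)) <= 1 /\ Rabs (c2 (B_ n t)) <= 1 /\
                         Rabs (c3 (B_ n t)) <= 1).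
{ intros n t; generalize (coord_le_norm3 (B_ n t)); unfold norm3.
  rewrite BB, sqrt_1; auto. }
assert (Z : forall u v w z : nat -> R -> R, forall l m : R -> R,
  uconv t0 r u l -> uconv t0 r v m ->
  (forall n t, Rabs (w n t) <= 1) -> (forall n t, Rabs (z n t) <= 1) ->
  uconv t0 r (fun n t => tau n * (u n t * w n t - v n t * z n t)) (fun _ => 0)).
{ intros u v w z l m Hu Hv Hw Hz.
  assert (S : forall p k, uconv t0 r p k ->
                uconv t0 r (fun n t => tau n * p n t) (fun _ => 0)).
  { intros p k Hp; apply (uconv_ext t0 r (fun n t => tau n * p n t) _ (fun t => 0 * k t));
      [ reflexivity | intros; ring | ].
    apply (uconv_mult t0 r (fun n _ => tau n) p (fun _ => 0) k);
      [ apply uconv_const, Ht | exact Hp ]. }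
  apply (uconv_ext t0 r (fun n t => tau n * u n t * w n t - tau n * v n t * z n t) _
           (fun _ => 0 - 0)); [ intros; ring | intros; ring | ].
  apply (uconv_minus t0 r _ _ (fun _ => 0) (fun _ => 0));
    apply uconv_zero_bounded with 1; eauto. }
split; [ | split ].
- apply (uconv_primitive t0 r _ _ (fun _ => c1 b) (fun _ => 0) Hr
    (fun n t => proj1 (DB n t)) (is_derive_Rconst _)); [ | exact L1 ].
  cbn [c1 c2 c3 scal3 cross fst snd]; eapply Z; try eassumption; intros; apply Bd.
- apply (uconv_primitive t0 r _ _ (fun _ => c2 b) (fun _ => 0) Hr
    (fun n t => proj1 (proj2 (DB n t))) (is_derive_Rconst _)); [ | exact L2 ].
  cbn [c1 c2 c3 scal3 cross fst snd]; eapply Z; try eassumption; intros; apply Bd.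
- apply (uconv_primitive t0 r _ _ (fun _ => c3 b) (fun _ => 0) Hr
    (fun n t => proj2 (proj2 (DB n t))) (is_derive_Rconst _)); [ | exact L3 ].
  cbn [c1 c2 c3 scal3 cross fst snd]; eapply Z; try eassumption; intros; apply Bd.
Qed.

Lemma derive3_cross_const (F : R -> R3) (p v : R3) (t : R) :
  derive3 F t v -> derive3 (fun u => cross p (F u)) t (cross p v) /\
                   derive3 (fun u => cross (F u) p) t (cross v p).
Proof.
intros [F1 [F2 F3]]; split; unfold derive3; cbn [c1 c2 c3 cross fst snd];
  (split; [ | split ]);
  (eapply is_derive_val;
    [ apply is_derive_Rminus; apply is_derive_Rmult;
      first [ eassumption | apply is_derive_Rconst ] | cbv beta; ring ]).
Qed.

Lemma derive3_sub (F G : R -> R3) (t : R) (v w : R3) :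
  derive3 F t v -> derive3 G t w -> derive3 (fun u => sub3 (F u) (G u)) t (sub3 v w).
Proof.
intros [F1 [F2 F3]] [G1 [G2 G3]].
split; [ | split ]; apply is_derive_Rminus; assumption.
Qed.

Lemma derive3_const (p : R3) (t : R) : derive3 (fun _ => p) t (0, 0, 0).
Proof. split; [ | split ]; apply is_derive_Rconst. Qed.

Lemma derive3_scal (k : R) (F : R -> R3) (t : R) (v : R3) :
  derive3 F t v -> derive3 (fun u => scal3 k (F u)) t (scal3 k v).
Proof.
intros [F1 [F2 F3]]; split; [ | split ]; apply is_derive_Rscal; assumption.
Qed.

Lemma derive3_dot_const (p : R3) (F : R -> R3) (t : R) (v : R3) :
  derive3 F t v -> is_derive (fun u => dot p (F u)) t (dot p v).
Proof.
intros HF; eapply is_derive_val;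
  [ exact (derive3_dot _ _ _ _ _ (derive3_const p t) HF) | ].
clear; vec; ring.
Qed.

(** The rescaled binormals [beta_] converge to a quarter turn of the limit curve,
    so the area swept by [beta_ n], measured along [b], converges to that swept by
    the limit curve.  For each [n] it equals the increment of the periodic
    function [phi n]. *)
Lemma limit_zero_area (t0 : R) (G_ V_ B_ : nat -> R -> R3) (G V : R -> R3)
    (tau : nat -> R) (b : R3) (a : R -> R) :
  (forall n t, derive3 (G_ n) t (V_ n t)) -> (forall t, derive3 G t (V t)) ->
  (forall n t, derive3 (B_ n) t (scal3 (tau n) (cross (V_ n t) (B_ n t)))) ->
  (forall n t, dot (B_ n t) (B_ n t) = 1) ->
  (forall n t, dot (B_ n t) (V_ n t) = 0) ->
  (forall n, G_ n (t0 + 2 * PI) = G_ n t0) ->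
  (forall n, B_ n (t0 + 2 * PI) = B_ n t0) ->
  (forall n, tau n <> 0) -> dot b b = 1 ->
  uconv3 t0 (2 * PI) V_ V -> uconv3 t0 (2 * PI) B_ (fun _ => b) ->
  (forall t, is_derive a t (dot b (cross (sub3 (G t) (G t0)) (V t)))) ->
  a t0 = a (t0 + 2 * PI).
Proof.
intros DG_ DG DB BB BV PG PB Hn Hb UV UB Da.
assert (HP := PI_RGT_0).
set (beta_ := fun n t => scal3 (/ tau n) (sub3 (B_ n t) (B_ n t0))).
set (beta := fun t => cross (sub3 (G t) (G t0)) b).
assert (Dbeta_ : forall n t, derive3 (beta_ n) t (cross (V_ n t) (B_ n t))).
{ intros n t.
  destruct (derive3_scal (/ tau n) _ _ _
    (derive3_sub _ _ _ _ _ (DB n t) (derive3_const (B_ n t0) t))) as [D1 [D2 D3]].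
  split; [ | split ]; (eapply is_derive_val; [ eassumption | ]);
    generalize (Hn n); clear; intros; vec; field; assumption. }
assert (Dbeta : forall t, derive3 beta t (cross (V t) b)).
{ intros t.
  destruct (proj2 (derive3_cross_const _ b _ _
    (derive3_sub _ _ _ _ _ (DG t) (derive3_const (G t0) t)))) as [D1 [D2 D3]].
  split; [ | split ]; (eapply is_derive_val; [ eassumption | clear; vec; ring ]). }
assert (Ucross : uconv3 t0 (2 * PI) (fun n t => cross (V_ n t) (B_ n t))
                   (fun t => cross (V t) b)) by (apply uconv3_cross; assumption).
assert (Zcv : forall u : nat -> R, forall l, (forall n, u n = l) -> Un_cv u l).
{ intros u l E eps He; exists 0%nat; intros n _; rewrite E; unfold Rdist.
  rewrite Rminus_diag, Rabs_R0; exact He. }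
assert (Ubeta : uconv3 t0 (2 * PI) beta_ beta).
{ destruct Ucross as [U1 [U2 U3]]; split; [ | split ].
  - apply (uconv_primitive t0 (2 * PI) _ _ _ _ ltac:(lra) (fun n t => proj1 (Dbeta_ n t))
      (fun t => proj1 (Dbeta t)) U1); apply Zcv; intros; clear; unfold beta, beta_; vec; ring.
  - apply (uconv_primitive t0 (2 * PI) _ _ _ _ ltac:(lra) (fun n t => proj1 (proj2 (Dbeta_ n t)))
      (fun t => proj1 (proj2 (Dbeta t))) U2); apply Zcv; intros; clear; unfold beta, beta_; vec; ring.
  - apply (uconv_primitive t0 (2 * PI) _ _ _ _ ltac:(lra) (fun n t => proj2 (proj2 (Dbeta_ n t)))
      (fun t => proj2 (proj2 (Dbeta t))) U3); apply Zcv; intros; clear; unfold beta, beta_; vec; ring. }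
set (phi := fun n t => / tau n * dot b (sub3 (G_ n t) (cross (B_ n t0) (beta_ n t)))).
assert (Dphi : forall n t, is_derive (phi n) t
  (dot b (cross (beta_ n t) (cross (V_ n t) (B_ n t))))).
{ intros n t; eapply is_derive_val.
  - apply is_derive_Rscal, derive3_dot_const, derive3_sub; [ apply DG_ | ].
    apply (proj1 (derive3_cross_const _ _ _ _ (Dbeta_ n t))).
  -
    (* V_n = B_n x (V_n x B_n), as B_n is a unit vector orthogonal to V_n. *)
    assert (E : V_ n t = cross (B_ n t) (cross (V_ n t) (B_ n t))).
    { generalize (BB n t) (BV n t).
      destruct (V_ n t) as [[v1 v2] v3]; destruct (B_ n t) as [[b1 b2] b3].
      clear; vec; intros E1 E2.
      f_equal; [ f_equal | ].
      - transitivity (v1 * (b1 * b1 + b2 * b2 + b3 * b3)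
          - b1 * (b1 * v1 + b2 * v2 + b3 * v3)); [ rewrite E1, E2 | ]; ring.
      - transitivity (v2 * (b1 * b1 + b2 * b2 + b3 * b3)
          - b2 * (b1 * v1 + b2 * v2 + b3 * v3)); [ rewrite E1, E2 | ]; ring.
      - transitivity (v3 * (b1 * b1 + b2 * b2 + b3 * b3)
          - b3 * (b1 * v1 + b2 * v2 + b3 * v3)); [ rewrite E1, E2 | ]; ring. }
    rewrite E at 1; unfold beta_.
    generalize (cross (V_ n t) (B_ n t)), (B_ n t), (B_ n t0), (Hn n).
    clear; intros; vec; field; assumption. }
assert (Uphi : uconv t0 (2 * PI)
  (fun n t => dot b (cross (beta_ n t) (cross (V_ n t) (B_ n t))))
  (fun t => dot b (cross (sub3 (G t) (G t0)) (V t)))).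
{ apply (uconv_ext t0 _ (fun n t => dot b (cross (beta_ n t) (cross (V_ n t) (B_ n t)))) _
    (fun t => dot b (cross (beta t) (cross (V t) b)))); [ reflexivity | | ].
  - intros t; unfold beta.
    transitivity (dot b b * dot b (cross (sub3 (G t) (G t0)) (V t)));
      [ clear; vec; ring | rewrite Hb; ring ].
  - apply (uconv3_dot t0 _ (fun _ _ => b) _ (fun _ => b)); [ apply uconv3_const | ].
    apply uconv3_cross; assumption. }
assert (U : uconv t0 (2 * PI) (fun n t => phi n t - phi n t0) (fun t => a t - a t0)).
{ apply (uconv_primitive t0 (2 * PI) _ _ _ _ ltac:(lra)) with (3 := Uphi).
  - intros n t; eapply is_derive_val;
      [ apply is_derive_Rminus; [ apply Dphi | apply is_derive_Rconst ] | ring ].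
  - intros t; eapply is_derive_val;
      [ apply is_derive_Rminus; [ apply Da | apply is_derive_Rconst ] | ring ].
  - apply Zcv; intros; ring. }
assert (L := uconv_point _ _ _ _ (t0 + 2 * PI) U ltac:(apply Rabs_le; lra)).
cbv beta in L.
assert (L0 : Un_cv (fun n => phi n (t0 + 2 * PI) - phi n t0) 0).
{ apply Zcv; intros n; unfold phi, beta_; rewrite PG, PB; ring. }
generalize (UL_sequence _ _ _ L L0); lra.
Qed.

(** * Curves on the circle *)

Lemma lift_periodic (g : S1 -> R3) (t : R) : lift g (t + 2 * PI) = lift g t.
Proof.
unfold lift; f_equal; apply angle_eq; exists 1%Z; ring.
Qed.

Lemma angle_neq (s t : R) : s < t < s + 2 * PI -> angle s <> angle t.
Proof.
intros Hst E; apply angle_eq in E; destruct E as [k Hk].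
assert (HP := PI_RGT_0).
assert (H1 : (k < 0)%Z) by (apply lt_IZR; nra).
assert (H2 : (-1 < k)%Z) by (apply lt_IZR; nra).
lia.
Qed.

Lemma derive3_D (g : S1 -> R3) (t : R) :
  C3 g ->
  derive3 (lift g) t (D 1 (lift g) t) /\
  derive3 (D 1 (lift g)) t (D 2 (lift g) t) /\
  derive3 (D 2 (lift g)) t (D 3 (lift g) t).
Proof.
assert (K : forall h : R -> R, C3_fun h -> forall k, (k < 3)%nat ->
  is_derive (Derive_n h k) t (Derive_n h (S k) t)).
{ intros h [H _] k Hk; apply Derive_correct, (H (S k) t); lia. }
intros [H1 [H2 H3]]; split; [ | split ]; (split; [ | split ]);
  unfold D; cbn [c1 c2 c3 fst snd].
- exact (K _ H1 0%nat ltac:(lia)).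
- exact (K _ H2 0%nat ltac:(lia)).
- exact (K _ H3 0%nat ltac:(lia)).
- exact (K _ H1 1%nat ltac:(lia)).
- exact (K _ H2 1%nat ltac:(lia)).
- exact (K _ H3 1%nat ltac:(lia)).
- exact (K _ H1 2%nat ltac:(lia)).
- exact (K _ H2 2%nat ltac:(lia)).
- exact (K _ H3 2%nat ltac:(lia)).
Qed.

Lemma coord_ext (p q : R3) : c1 p = c1 q -> c2 p = c2 q -> c3 p = c3 q -> p = q.
Proof.
destruct p as [[p1 p2] p3], q as [[q1 q2] q3]; cbn; intros -> -> ->; reflexivity.
Qed.

Lemma derive3_periodic (F V : R -> R3) :
  (forall t, derive3 F t (V t)) -> (forall t, F (t + 2 * PI) = F t) ->
  forall t, V (t + 2 * PI) = V t.
Proof.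
intros DF PF t.
assert (E1 := periodic_derive _ _ (2 * PI) (fun t => proj1 (DF t))
                ltac:(intros; cbv beta; rewrite PF; reflexivity) t).
assert (E2 := periodic_derive _ _ (2 * PI) (fun t => proj1 (proj2 (DF t)))
                ltac:(intros; cbv beta; rewrite PF; reflexivity) t).
assert (E3 := periodic_derive _ _ (2 * PI) (fun t => proj2 (proj2 (DF t)))
                ltac:(intros; cbv beta; rewrite PF; reflexivity) t).
exact (coord_ext _ _ E1 E2 E3).
Qed.

Lemma constant_speed_orthogonal (V A : R -> R3) (k : R) :
  (forall t, derive3 V t (A t)) -> (forall t, dot (V t) (V t) = k) ->
  forall t, dot (V t) (A t) = 0.
Proof.
intros DV Hk t.
enough (dot (A t) (V t) + dot (V t) (A t) = 0).
{ replace (dot (A t) (V t)) with (dot (V t) (A t)) in H by (clear; vec; ring); lra. }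
apply (is_derive_inj (fun u => dot (V u) (V u)) t); [ apply derive3_dot; apply DV | ].
apply (is_derive_Rext (fun _ => k)); [ intros; rewrite Hk; reflexivity | ].
apply is_derive_Rconst.
Qed.

Lemma lagrange_identity (p q : R3) :
  dot (cross p q) (cross p q) = dot p p * dot q q - dot p q * dot p q.
Proof. vec; ring. Qed.

(** At constant speed the acceleration is orthogonal to the velocity, and the
    curvature is its norm up to a constant factor. *)
Lemma curvature_cross_pos (g : S1 -> R3) (c : R) :
  C3 g -> 0 < c -> (forall t, speed (lift g) t = c) ->
  (forall t, curvature (lift g) t <> 0) ->
  forall t, 0 < dot (cross (D 1 (lift g) t) (D 2 (lift g) t))
                    (cross (D 1 (lift g) t) (D 2 (lift g) t)).
Proof.
intros Hg Hc Hs Hk t.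
assert (VV : forall u, dot (D 1 (lift g) u) (D 1 (lift g) u) = c * c).
{ intros u; rewrite <- norm3_sqr; change (norm3 (D 1 (lift g) u)) with (speed (lift g) u).
  rewrite Hs; reflexivity. }
assert (DV := fun u => proj1 (proj2 (derive3_D g u Hg))).
rewrite lagrange_identity, (constant_speed_orthogonal _ _ _ DV VV), VV.
enough (Hpos : 0 < dot (D 2 (lift g) t) (D 2 (lift g) t))
  by (generalize (Rmult_lt_0_compat _ _ (Rmult_lt_0_compat _ _ Hc Hc) Hpos); lra).
destruct (dot_pos (D 2 (lift g) t)) as [Hpos | Hz]; [ exact Hpos | exfalso ].
apply (Hk t); unfold curvature.
assert (Ez := dot_zero _ (eq_sym Hz)).
destruct (derive3_scal (/ c) _ _ _ (DV t)) as [D1 [D2 D3]].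
rewrite Ez in D1, D2, D3.
assert (E : D 1 (unit_tangent (lift g)) t = (0, 0, 0)).
{ assert (Eu : forall u, unit_tangent (lift g) u = scal3 (/ c) (D 1 (lift g) u))
    by (intros u; unfold unit_tangent; rewrite Hs; reflexivity).
  unfold D at 1; cbn [Derive_n]; f_equal; [ f_equal | ].
  - apply is_derive_unique.
    apply (is_derive_Rext (fun u => c1 (scal3 (/ c) (D 1 (lift g) u))));
      [ intros; rewrite Eu; reflexivity | ].
    eapply is_derive_val; [ exact D1 | clear; vec; ring ].
  - apply is_derive_unique.
    apply (is_derive_Rext (fun u => c2 (scal3 (/ c) (D 1 (lift g) u))));
      [ intros; rewrite Eu; reflexivity | ].
    eapply is_derive_val; [ exact D2 | clear; vec; ring ].
  - apply is_derive_unique.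
    apply (is_derive_Rext (fun u => c3 (scal3 (/ c) (D 1 (lift g) u))));
      [ intros; rewrite Eu; reflexivity | ].
    eapply is_derive_val; [ exact D3 | clear; vec; ring ]. }
rewrite E; unfold norm3.
replace (dot (scal3 (/ speed (lift g) t) (0, 0, 0)) (scal3 (/ speed (lift g) t) (0, 0, 0)))
  with 0 by (clear; vec; ring).
apply sqrt_0.
Qed.

Lemma derive3_zero_const (F : R -> R3) :
  (forall t, derive3 F t (0, 0, 0)) -> forall s t, F s = F t.
Proof.
intros DF s t.
assert (E1 := derive_zero_const _ (fun t => proj1 (DF t)) s t).
assert (E2 := derive_zero_const _ (fun t => proj1 (proj2 (DF t))) s t).
assert (E3 := derive_zero_const _ (fun t => proj2 (proj2 (DF t))) s t).
exact (coord_ext _ _ E1 E2 E3).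
Qed.

(** Otherwise the acceleration, being orthogonal and parallel to the velocity,
    would vanish, and constant nonzero velocity is incompatible with periodicity. *)
Lemma closed_curve_not_straight (F V A : R -> R3) (k : R) :
  (forall t, derive3 F t (V t)) -> (forall t, derive3 V t (A t)) ->
  (forall t, F (t + 2 * PI) = F t) ->
  0 < k -> (forall t, dot (V t) (V t) = k) ->
  exists t, 0 < dot (cross (V t) (A t)) (cross (V t) (A t)).
Proof.
intros DF DV PF Hk VV; assert (HP := PI_RGT_0).
apply NNPP; intros Hn.
assert (Az : forall t, A t = (0, 0, 0)).
{ intros t; apply dot_zero.
  destruct (dot_pos (A t)) as [Hpos | Hz]; [ exfalso | auto ].
  apply Hn; exists t.
  rewrite lagrange_identity, (constant_speed_orthogonal _ _ _ DV VV), VV.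
  generalize (Rmult_lt_0_compat _ _ Hk Hpos); lra. }
assert (Vc : forall t, V t = V 0).
{ intros t; apply derive3_zero_const; intros u; rewrite <- (Az u); apply DV. }
assert (Z : forall f f' : R -> R, (forall t, is_derive f t (f' t)) ->
  (forall t, f' t = f' 0) -> f (0 + 2 * PI) = f 0 -> f' 0 = 0).
{ intros f f' Df Cf Pf.
  destruct (mean_value f f' 0 (0 + 2 * PI) Df ltac:(lra)) as [w [_ E]].
  rewrite Pf, Cf in E; apply Rmult_eq_reg_r with (2 * PI); lra. }
assert (Z1 := Z _ _ (fun t => proj1 (DF t)) ltac:(intros; cbv beta; rewrite Vc; reflexivity)
  ltac:(cbv beta; rewrite PF; reflexivity)).
assert (Z2 := Z _ _ (fun t => proj1 (proj2 (DF t)))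
  ltac:(intros; cbv beta; rewrite Vc; reflexivity)
  ltac:(cbv beta; rewrite PF; reflexivity)).
assert (Z3 := Z _ _ (fun t => proj2 (proj2 (DF t)))
  ltac:(intros; cbv beta; rewrite Vc; reflexivity)
  ltac:(cbv beta; rewrite PF; reflexivity)).
cbv beta in Z1, Z2, Z3.
specialize (VV 0); unfold dot in VV; rewrite Z1, Z2, Z3 in VV; lra.
Qed.

(** Three vectors in the plane orthogonal to [v] are linearly dependent. *)
Lemma plane_normal_parallel (v p q r : R3) :
  v <> (0, 0, 0) -> dot v p = 0 -> dot v q = 0 -> dot v r = 0 ->
  dot (cross p q) r = 0.
Proof.
intros Hv Hp Hq Hr.
assert (Hvv : dot v v <> 0) by (intros E; apply Hv, dot_zero, E).
apply Rmult_eq_reg_l with (dot v v); [ | exact Hvv ].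
transitivity (dot v p * dot (cross q r) v - dot v q * dot (cross p r) v
              + dot v r * dot (cross p q) v); [ clear; vec; ring | ].
rewrite Hp, Hq, Hr; ring.
Qed.

(** The square of det (b, e, p) is the Gram determinant of these vectors. *)
Lemma gram_identity (b e p : R3) :
  dot (cross b e) p * dot (cross b e) p =
  dot b b * (dot e e * dot p p - dot e p * dot e p)
  - dot b e * (dot b e * dot p p - dot e p * dot b p)
  + dot b p * (dot b e * dot e p - dot e e * dot b p).
Proof. vec; ring. Qed.

Lemma frame_norm (b e p : R3) :
  dot b b = 1 -> dot e e = 1 -> dot b e = 0 -> dot b p = 0 ->
  dot e p * dot e p + dot (cross b e) p * dot (cross b e) p = dot p p.
Proof.
intros H1 H2 H3 H4; rewrite gram_identity, H1, H2, H3, H4; ring.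
Qed.

Lemma frame_area (b e p q : R3) :
  dot b b = 1 -> dot e e = 1 -> dot b e = 0 ->
  dot e p * dot (cross b e) q - dot (cross b e) p * dot e q = dot b (cross p q).
Proof.
intros H1 H2 H3.
transitivity (dot e e * dot b (cross p q) - dot b e * dot e (cross p q));
  [ clear; vec; ring | rewrite H2, H3; ring ].
Qed.

(** The plane is given the orthonormal coordinates along [e], the direction of
    the velocity at [t0], and [f = cross b e]. *)
Lemma planar_crossing (F V A J : R -> R3) (b : R3) (c t0 : R) :
  (forall t, derive3 F t (V t)) -> (forall t, derive3 V t (A t)) ->
  (forall t, derive3 A t (J t)) -> (forall t, F (t + 2 * PI) = F t) ->
  0 < c -> (forall t, dot (V t) (V t) = c * c) ->
  dot b b = 1 -> (forall t, dot b (V t) = 0) ->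
  (forall t, 0 <= dot b (cross (V t) (A t))) ->
  (forall a, (forall t, is_derive a t (dot b (cross (sub3 (F t) (F t0)) (V t)))) ->
     a t0 = a (t0 + 2 * PI)) ->
  exists u v, u < v < u + 2 * PI /\ F u = F v.
Proof.
intros DF DV DA PF Hc VV Hb BV K Harea.
set (e := scal3 (/ c) (V t0)).
assert (Ee : dot e e = 1).
{ transitivity (/ c * / c * dot (V t0) (V t0)); [ unfold e; clear; vec; ring | ].
  rewrite VV; field; lra. }
assert (Eb : dot b e = 0).
{ transitivity (/ c * dot b (V t0)); [ unfold e; clear; vec; ring | rewrite BV; ring ]. }
set (f := cross b e).
assert (Dx := fun t => derive3_dot_const e _ _ _ (DF t)).
assert (Dy := fun t => derive3_dot_const f _ _ _ (DF t)).
assert (Dx1 := fun t => derive3_dot_const e _ _ _ (DV t)).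
assert (Dy1 := fun t => derive3_dot_const f _ _ _ (DV t)).
assert (Dx2 := fun t => derive3_dot_const e _ _ _ (DA t)).
assert (Dy2 := fun t => derive3_dot_const f _ _ _ (DA t)).
assert (Cont := fun p t => derive3_dot_const p _ _ _ (DF t)).
assert (Area : forall t,
  (dot e (F t) - dot e (F t0)) * dot f (V t) - (dot f (F t) - dot f (F t0)) * dot e (V t)
  = dot b (cross (sub3 (F t) (F t0)) (V t))).
{ intros t; rewrite <- (frame_area b e _ _ Hb Ee Eb); fold f; clear; vec; ring. }
destruct (continuous_primitive (fun t => (dot e (F t) - dot e (F t0)) * dot f (V t)
  - (dot f (F t) - dot f (F t0)) * dot e (V t)) 0) as [a [_ Da]].
{ assert (Csub : forall p, continuity (fun t => dot p (F t) - dot p (F t0))).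
  { intros p; apply (continuity_minus (fun t => dot p (F t)) (fun _ => dot p (F t0))).
    - apply (derivable_continuity _ _ (Cont p)).
    - apply continuity_const; intros ? ?; reflexivity. }
  apply (continuity_minus
    (fun t => (dot e (F t) - dot e (F t0)) * dot f (V t))
    (fun t => (dot f (F t) - dot f (F t0)) * dot e (V t))).
  - apply (continuity_mult (fun t => dot e (F t) - dot e (F t0)) (fun t => dot f (V t)));
      [ apply Csub | apply (derivable_continuity _ _ Dy1) ].
  - apply (continuity_mult (fun t => dot f (F t) - dot f (F t0)) (fun t => dot e (V t)));
      [ apply Csub | apply (derivable_continuity _ _ Dx1) ]. }
destruct (zero_area_crossing c t0 (fun t => dot e (F t)) (fun t => dot f (F t))
  (fun t => dot e (V t)) (fun t => dot f (V t)) (fun t => dot e (A t))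
  (fun t => dot f (A t)) a Hc Dx Dy Dx1 Dy1) as [u [v [Huv [Ex Ey]]]].
- apply (derivable_continuity _ _ Dx2).
- apply (derivable_continuity _ _ Dy2).
- intros t; rewrite PF; reflexivity.
- intros t; rewrite PF; reflexivity.
- intros t; rewrite <- (VV t); apply frame_norm; auto.
- intros t; unfold f; rewrite (frame_area b e _ _ Hb Ee Eb); apply K.
- exact Da.
- apply Harea; intros t; rewrite <- Area; apply Da.
- exists u, v; split; [ exact Huv | ].
  assert (Ez : dot b (F u) = dot b (F v)).
  { apply (derive_zero_const (fun t => dot b (F t))); intros t.
    rewrite <- (BV t); apply derive3_dot_const, DF. }
  assert (Z : sub3 (F u) (F v) = (0, 0, 0)).
  { assert (Sub : forall p, dot p (sub3 (F u) (F v)) = dot p (F u) - dot p (F v))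
      by (intros; clear; vec; ring).
    apply dot_zero; rewrite <- (frame_norm b e _ Hb Ee Eb).
    - fold f; rewrite !Sub, Ex, Ey; ring.
    - rewrite Sub, Ez; ring. }
  destruct (F u) as [[p1 p2] p3], (F v) as [[q1 q2] q3]; vec.
  injection Z; intros; f_equal; [ f_equal | ]; lra.
Qed.

Lemma converges_uconv3 (g_ : nat -> S1 -> R3) (g : S1 -> R3) (k : nat) (t0 r M : R) :
  converges_C3 g_ g -> (k <= 3)%nat ->
  (forall t, Rabs (t - t0) <= r -> norm3 (D k (lift g) t) <= M) ->
  uconv3 t0 r (fun n => D k (lift (g_ n))) (D k (lift g)).
Proof.
intros H Hk HM.
assert (Bd : forall c : R3 -> R, (forall p, Rabs (c p) <= norm3 p) ->
  (forall p q, c (sub3 p q) = c p - c q) ->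
  uconv t0 r (fun n t => c (D k (lift (g_ n)) t)) (fun t => c (D k (lift g) t))).
{ intros c Hc Hs; split.
  - exists (Rabs M + 1); split; [ generalize (Rabs_pos M); lra | ]; intros t Ht.
    generalize (Hc (D k (lift g) t)), (HM t Ht), (Rle_abs M); lra.
  - intros eps He; destruct (H k Hk eps He) as [N HN]; exists N; intros n Hn t _.
    rewrite <- Hs; apply Rle_lt_trans with (1 := Hc _), HN, Hn. }
split; [ | split ]; apply Bd; try reflexivity; intros; apply coord_le_norm3.
Qed.

Theorem theorem5 :
  forall (gamma_ : nat -> S1 -> R3) (gamma : S1 -> R3) (c tau : nat -> R),
    (forall n : nat, C3 (gamma_ n)) ->
    C3 gamma ->
    converges_C3 gamma_ gamma ->
    in_a_plane (image gamma) ->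
    ~ is_a_point (image gamma) ->
    (forall n : nat,
       0 < c n /\
       (forall t : R, speed (lift (gamma_ n)) t = c n) /\
       (forall t : R, curvature (lift (gamma_ n)) t <> 0) /\
       tau n <> 0 /\
       (forall t : R, torsion (lift (gamma_ n)) t = tau n)) ->
    ~ embedding gamma /\
    exists s t : S1, s <> t /\ gamma s = gamma t.
Proof.
intros gamma_ gamma c tau HC_ HC Hconv [v [d [Hv Hplane]]] Hpoint Hn.
enough (Cross : exists u w, u < w < u + 2 * PI /\ lift gamma u = lift gamma w).
{ destruct Cross as [u [w [Huw E]]].
  assert (Hne := angle_neq u w Huw).
  split; [ intros [Inj _]; exact (Hne (Inj _ _ E)) | ].
  exists (angle u), (angle w); split; [ exact Hne | exact E ]. }
assert (HP := PI_RGT_0).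
set (F := lift gamma); set (V := D 1 F); set (A := D 2 F); set (J := D 3 F).
assert (DF : forall t, derive3 F t (V t))
  by exact (fun t => proj1 (derive3_D gamma t HC)).
assert (DV : forall t, derive3 V t (A t))
  by exact (fun t => proj1 (proj2 (derive3_D gamma t HC))).
assert (DA : forall t, derive3 A t (J t))
  by exact (fun t => proj2 (proj2 (derive3_D gamma t HC))).
assert (PF : forall t, F (t + 2 * PI) = F t) by (intros; apply lift_periodic).
set (F_ := fun n => lift (gamma_ n)).
set (V_ := fun n => D 1 (F_ n)); set (A_ := fun n => D 2 (F_ n)).
set (J_ := fun n => D 3 (F_ n)).
assert (DF_ : forall n t, derive3 (F_ n) t (V_ n t))
  by exact (fun n t => proj1 (derive3_D (gamma_ n) t (HC_ n))).
assert (DV_ : forall n t, derive3 (V_ n) t (A_ n t))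
  by exact (fun n t => proj1 (proj2 (derive3_D (gamma_ n) t (HC_ n)))).
assert (DA_ : forall n t, derive3 (A_ n) t (J_ n t))
  by exact (fun n t => proj2 (proj2 (derive3_D (gamma_ n) t (HC_ n)))).
assert (PF_ : forall n t, F_ n (t + 2 * PI) = F_ n t) by (intros; apply lift_periodic).
assert (VV_ : forall n t, dot (V_ n t) (V_ n t) = c n * c n).
{ intros n t; rewrite <- norm3_sqr; destruct (Hn n) as [_ [Hs _]].
  change (norm3 (V_ n t)) with (speed (F_ n) t); unfold F_; rewrite Hs; reflexivity. }
assert (W_ : forall n t, 0 < dot (cross (V_ n t) (A_ n t)) (cross (V_ n t) (A_ n t))).
{ intros n; destruct (Hn n) as [Hc [Hs [Hk _]]].
  apply (curvature_cross_pos _ (c n)); auto. }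
(* Pointwise convergence at t is uniform convergence on the ball of radius 0. *)
assert (Pt : forall k t, (k <= 3)%nat -> uconv3 t 0 (fun n => D k (F_ n)) (D k F)).
{ intros k t Hk; apply converges_uconv3 with (norm3 (D k F t)); auto.
  intros s Hs; assert (s - t = 0).
  { apply NNPP; intros H0; generalize (Rabs_pos_lt _ H0); lra. }
  replace s with t by lra; apply Rle_refl. }
assert (R0 : forall t, Rabs (t - t) <= 0)
  by (intros; rewrite Rminus_diag, Rabs_R0; lra).
assert (LVV : forall t, Un_cv (fun n => c n * c n) (dot (V t) (V t))).
{ intros t.
  assert (L := uconv_point _ _ _ _ t
    (uconv3_dot _ _ _ _ _ _ (Pt 1%nat t ltac:(lia)) (Pt 1%nat t ltac:(lia))) (R0 t)).
  intros eps He; destruct (L eps He) as [N HN]; exists N; intros n HNn.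
  rewrite <- (VV_ n t); apply HN, HNn. }
set (C := norm3 (V 0)).
assert (VV : forall t, dot (V t) (V t) = C * C).
{ intros t; unfold C; rewrite norm3_sqr; apply (UL_sequence _ _ _ (LVV t) (LVV 0)). }
assert (HC0 : 0 < C).
{ destruct (sqrt_pos (dot (V 0) (V 0))) as [Hpos | Hz]; [ exact Hpos | exfalso ].
  change (0 = C) in Hz.
  assert (Vz : forall t, V t = (0, 0, 0)) by (intros; apply dot_zero; rewrite VV, <- Hz; ring).
  apply Hpoint; exists (F 0); intros q; split.
  - intros [p <-]; destruct (angle_surj p) as [t ->].
    apply (derive3_zero_const F); intros u; rewrite <- (Vz u); apply DF.
  - intros ->; exists (angle 0); reflexivity. }
destruct (closed_curve_not_straight F V A (C * C) DF DV PF ltac:(nra) VV) as [t0 Ht0].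
assert (Pl0 : forall t, dot v (V t) = 0).
{ intros t; apply (is_derive_inj (fun u => dot v (F u)) t).
  - apply derive3_dot_const, DF.
  - apply (is_derive_Rext (fun _ => d)); [ | apply is_derive_Rconst ].
    intros u; symmetry; apply Hplane; exists (angle u); reflexivity. }
assert (Pl1 : forall t, dot v (A t) = 0).
{ intros t; apply (is_derive_inj (fun u => dot v (V u)) t).
  - apply derive3_dot_const, DV.
  - apply (is_derive_Rext (fun _ => 0)); [ | apply is_derive_Rconst ].
    intros u; symmetry; apply Pl0. }
assert (Pl2 : forall t, dot v (J t) = 0).
{ intros t; apply (is_derive_inj (fun u => dot v (A u)) t).
  - apply derive3_dot_const, DA.
  - apply (is_derive_Rext (fun _ => 0)); [ | apply is_derive_Rconst ].
    intros u; symmetry; apply Pl1. }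
assert (UW : uconv3 t0 0 (fun n t => cross (V_ n t) (A_ n t)) (fun t => cross (V t) (A t)))
  by (apply uconv3_cross; apply Pt; lia).
assert (LWW := uconv_point _ _ _ _ t0 (uconv3_dot _ _ _ _ _ _ UW UW) (R0 t0)).
assert (LWJ := uconv_point _ _ _ _ t0
  (uconv3_dot _ _ _ _ _ _ UW (Pt 3%nat t0 ltac:(lia))) (R0 t0)).
cbv beta in LWW, LWJ.
apply is_lim_seq_Reals in LWW; apply is_lim_seq_Reals in LWJ.
assert (Ltau : Un_cv tau 0).
{ apply is_lim_seq_Reals.
  apply is_lim_seq_ext with
    (fun n => dot (cross (V_ n t0) (A_ n t0)) (J_ n t0) /
              dot (cross (V_ n t0) (A_ n t0)) (cross (V_ n t0) (A_ n t0))).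
  - intros n; destruct (Hn n) as [_ [_ [_ [_ Htau]]]]; rewrite <- (Htau t0).
    unfold torsion; rewrite <- norm3_sqr; simpl; rewrite Rmult_1_r; reflexivity.
  - replace (Finite 0) with
      (Finite (dot (cross (V t0) (A t0)) (J t0) /
               dot (cross (V t0) (A t0)) (cross (V t0) (A t0)))).
    + apply is_lim_seq_div'; [ exact LWJ | exact LWW | lra ].
    + rewrite (plane_normal_parallel v) by auto; f_equal; field; lra. }
set (B_ := fun n => binormal (V_ n) (A_ n)).
set (b := binormal V A t0).
assert (Lw : is_lim_seq (fun n => / norm3 (cross (V_ n t0) (A_ n t0)))
               (/ norm3 (cross (V t0) (A t0)))).
{ apply is_lim_seq_inv with (l := Finite (norm3 (cross (V t0) (A t0)))) .
  - apply (is_lim_seq_continuous sqrt _ _); [ | exact LWW ].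
    apply continuity_pt_sqrt; lra.
  - assert (0 < norm3 (cross (V t0) (A t0))) by (apply sqrt_lt_R0, Ht0).
    intros E; injection E; lra. }
assert (LB : Un_cv (fun n => c1 (B_ n t0)) (c1 b) /\ Un_cv (fun n => c2 (B_ n t0)) (c2 b) /\
             Un_cv (fun n => c3 (B_ n t0)) (c3 b)).
{ destruct UW as [U1 [U2 U3]].
  split; [ | split ]; apply is_lim_seq_Reals;
    (apply is_lim_seq_mult'; [ exact Lw | apply is_lim_seq_Reals ]).
  - exact (uconv_point _ _ _ _ t0 U1 (R0 t0)).
  - exact (uconv_point _ _ _ _ t0 U2 (R0 t0)).
  - exact (uconv_point _ _ _ _ t0 U3 (R0 t0)). }
destruct LB as [LB1 [LB2 LB3]].
assert (DB_ : forall n t, derive3 (B_ n) t (scal3 (tau n) (cross (V_ n t) (B_ n t)))).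
{ intros n; apply binormal_equation with (J_ n); auto.
  destruct (Hn n) as [_ [_ [_ [_ Htau]]]]; exact Htau. }
assert (UV : forall r, uconv3 t0 r V_ V).
{ intros r; apply converges_uconv3 with C; auto.
  intros t _; unfold norm3; fold F V; rewrite VV, sqrt_square; lra. }
assert (UB : forall r, 0 <= r -> uconv3 t0 r B_ (fun _ => b)).
{ intros r Hr; apply binormal_uconv with V_ V tau; auto.
  intros n t; apply (binormal_frame _ _ _ (W_ n t)). }
assert (Hb : dot b b = 1) by apply (binormal_frame _ _ _ Ht0).
assert (BV : forall t, dot b (V t) = 0).
{ intros t; unfold b, binormal.
  transitivity (/ norm3 (cross (V t0) (A t0)) * dot (cross (V t0) (A t0)) (V t)).
  - clear; vec; ring.
  - rewrite (plane_normal_parallel v) by auto; ring. }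
apply (planar_crossing F V A J b C t0); auto.
- intros t.
  assert (U0 : uconv3 t 0 B_ (fun _ => b)).
  { assert (Hr := Rabs_pos (t - t0)).
    destruct (UB _ Hr) as [U1 [U2 U3]].
    assert (Re : forall u l, uconv t0 (Rabs (t - t0)) u l -> uconv t 0 u l).
    { intros u l [[M [HM Bd]] H].
      assert (Hs : forall s, Rabs (s - t) <= 0 -> Rabs (s - t0) <= Rabs (t - t0)).
      { intros s Hs; assert (s - t = 0).
        { apply NNPP; intros H0; generalize (Rabs_pos_lt _ H0); lra. }
        replace s with t by lra; lra. }
      split; [ exists M; auto | ].
      intros eps He; destruct (H eps He) as [N HN]; exists N; auto. }
    split; [ | split ]; apply Re; assumption. }
  assert (L := uconv_point _ _ _ _ t (uconv3_dot _ _ _ _ _ _ U0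
    (uconv3_cross _ _ _ _ _ _ (Pt 1%nat t ltac:(lia)) (Pt 2%nat t ltac:(lia)))) (R0 t)).
  apply is_lim_seq_Reals in L.
  assert (Le := is_lim_seq_le (fun _ => 0) _ 0 _
    (fun n => proj2 (proj2 (binormal_frame _ _ _ (W_ n t)))) (is_lim_seq_const 0) L).
  exact Le.
- intros a Da.
  apply (limit_zero_area t0 F_ V_ B_ F V tau b a); auto.
  + intros n t; apply (binormal_frame _ _ _ (W_ n t)).
  + intros n t; apply (binormal_frame _ _ _ (W_ n t)).
  + intros n; unfold B_, binormal.
    assert (PV := derive3_periodic _ _ (DF_ n) (PF_ n)).
    rewrite PV, (derive3_periodic _ _ (DV_ n) PV); reflexivity.
  + intros n; apply Hn.
  + apply UB; lra.
Qed.
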